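(* Let $p$ be a prime, let $G$ be a finite $p$-group and let $N$ be a normal subgroup of $G$. Put $\mathbf{p}=p$ if $p$ is odd and $\mathbf{p}=4$ if $p=2$. (a) If $N$ is potent or $\gamma_p(N)=1$, then $\exp(\nu(G))$ divides $\mathbf{p}\cdot\exp(\nu(G/N))\cdot\exp(N)$. (b) If $p\geq 3$ and $\gamma_{p-2}(N)\leq N^p$, then $\exp(\nu(G))$ divides $\exp(\nu(G/N))\cdot\exp(N)$.
   Context: Conventions: $x^y=y^{-1}xy$ and $[x,y]=x^{-1}y^{-1}xy$. $\gamma_1(H)=H$ and $\gamma_{i+1}(H)=[\gamma_i(H),H]$ is the lower central series. For a group $H$ and $k\ge 1$, $H^{k}$ is the subgroup generated by all $k$-th powers of elements of $H$. $\exp(H)$ is the exponent of $H$. A finite $p$-group $H$ is potent if $\gamma_{p-1}(H)\leq H^p$ (for $p>2$) or $H'\leq H^4$ (for $p=2$). For a group $G$, let $\varphi:G\to G^{\varphi}$, $g\mapsto g^{\varphi}$, be an isomorphism onto a copy $G^{\varphi}$ of $G$, and define $\nu(G)$ to be the group generated by $G\cup G^{\varphi}$ (keeping all relations of $G$ and of $G^\varphi$) subject to the additional relations $[g_1,g_2^{\varphi}]^{g_3}=[g_1^{g_3},(g_2^{g_3})^{\varphi}]=[g_1,g_2^{\varphi}]^{g_3^{\varphi}}$ for all $g_1,g_2,g_3\in G$. *)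

(* Defs.v *)
From HB Require Import structures.
From mathcomp Require Import all_boot all_fingroup all_solvable.
From mathcomp Require Import generic_quotient boolp.

Set Implicit Arguments.
Unset Strict Implicit.
Unset Printing Implicit Defensive.

Local Open Scope group_scope.
Local Open Scope quotient_scope.

(* The group < X | u = v whenever R u v >, as the quotient of the words in the
   letters x (encoded (x, true)) and x^-1 (encoded (x, false)). It may be
   infinite, hence a groupType rather than a finGroupType. *)

Definition word (X : Type) := seq (X * bool).

Definition winv (X : Type) (w : word X) : word X :=
  rev [seq (l.1, ~~ l.2) | l <- w].

Definition wconj (X : Type) (u v : word X) : word X := winv v ++ (u ++ v).

Definition wcomm (X : Type) (u v : word X) : word X :=
  winv u ++ (winv v ++ (u ++ v)).

Inductive word_eq (X : Type) (R : word X -> word X -> Prop) :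
    word X -> word X -> Prop :=
| WordRel u v of R u v : word_eq R u v
| WordCancel x b : word_eq R [:: (x, b); (x, ~~ b)] [::]
| WordCat u u' v v' of word_eq R u u' & word_eq R v v' :
    word_eq R (u ++ v) (u' ++ v')
| WordRefl u : word_eq R u u
| WordSym u v of word_eq R u v : word_eq R v u
| WordTrans u v w of word_eq R u v & word_eq R v w : word_eq R u w.

Section Presentation.
Variables (X : choiceType) (R : word X -> word X -> Prop).

Definition word_eqb : rel (word X) := fun u v => `[< word_eq R u v >].

Lemma word_eqb_refl : reflexive word_eqb.
Proof. by move=> u; apply/asboolP; apply: WordRefl. Qed.

Lemma word_eqb_sym : symmetric word_eqb.
Proof. by move=> u v; apply/asboolP/asboolP; apply: WordSym. Qed.

Lemma word_eqb_trans : transitive word_eqb.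
Proof.
by move=> v u w /asboolP uv /asboolP vw; apply/asboolP; apply: WordTrans vw.
Qed.

Canonical word_equiv :=
  EquivRel word_eqb word_eqb_refl word_eqb_sym word_eqb_trans.

Definition presented := {eq_quot word_equiv}.

HB.instance Definition _ := Choice.on presented.
HB.instance Definition _ := EqQuotient.on presented.

Definition word_class (w : word X) : presented := \pi_presented w.

Lemma word_classP u v : word_class u = word_class v <-> word_eq R u v.
Proof.
split=> [/eqmodP/asboolP // | uv].
by apply/eqmodP/asboolP.
Qed.

Lemma word_class_repr (a : presented) : word_class (repr a) = a.
Proof. exact: reprK. Qed.

Definition presented_mul (a b : presented) := word_class (repr a ++ repr b).
Definition presented_inv (a : presented) := word_class (winv (repr a)).

Lemma winv_cat (u v : word X) : winv (u ++ v) = winv v ++ winv u.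
Proof. by rewrite /winv map_cat rev_cat. Qed.

Lemma winvK : involutive (@winv X).
Proof.
move=> w; rewrite /winv map_rev revK -map_comp -[RHS]map_id.
by apply: eq_map => -[x b] /=; rewrite negbK.
Qed.

Lemma word_eq_mulwV w : word_eq R (w ++ winv w) [::].
Proof.
elim: w => [|[x b] w IHw]; first exact: WordRefl.
rewrite /winv map_cons rev_cons -cats1 -/(winv w) /=.
apply: WordTrans (WordCancel R x b).
apply: (@WordCat _ _ [:: _] [:: _] _ [:: _] (WordRefl _ _)).
by rewrite catA; apply: (WordCat IHw (WordRefl _ _)).
Qed.

Lemma word_eq_mulVw w : word_eq R (winv w ++ w) [::].
Proof. by rewrite -{2}[w]winvK; apply: word_eq_mulwV. Qed.

Lemma word_eq_winv u v : word_eq R u v -> word_eq R (winv u) (winv v).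
Proof.
move=> uv; have rE w := WordRefl R w.
have /WordSym eqv : word_eq R (winv u ++ (v ++ winv v)) (winv u).
  by rewrite -{2}[winv u]cats0; apply: (WordCat (rE _) (word_eq_mulwV v)).
apply: (WordTrans eqv); rewrite catA -[X in word_eq R _ X]cat0s.
apply: (WordCat _ (rE _)); apply: WordTrans (word_eq_mulVw u).
by apply: WordCat (rE _) (WordSym uv).
Qed.

Lemma word_eq_repr w : word_eq R (repr (word_class w)) w.
Proof. by apply/word_classP; rewrite word_class_repr. Qed.

Lemma word_class_cat u v :
  presented_mul (word_class u) (word_class v) = word_class (u ++ v).
Proof. by apply/word_classP; apply: WordCat; apply: word_eq_repr. Qed.

Lemma word_class_winv u : presented_inv (word_class u) = word_class (winv u).
Proof. by apply/word_classP/word_eq_winv/word_eq_repr. Qed.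

Let presented_ind (P : presented -> Prop) :
  (forall w, P (word_class w)) -> forall a, P a.
Proof. by move=> Pw a; rewrite -[a]word_class_repr. Qed.

Lemma presented_mulA : associative presented_mul.
Proof.
elim/presented_ind=> u; elim/presented_ind=> v; elim/presented_ind=> w.
by rewrite !word_class_cat catA.
Qed.

Lemma presented_mul1 : left_id (word_class [::]) presented_mul.
Proof. by elim/presented_ind=> u; rewrite word_class_cat. Qed.

Lemma presented_mulr1 : right_id (word_class [::]) presented_mul.
Proof. by elim/presented_ind=> u; rewrite word_class_cat cats0. Qed.

Lemma presented_mulV :
  left_inverse (word_class [::]) presented_inv presented_mul.
Proof.
elim/presented_ind=> u; rewrite word_class_winv word_class_cat.
by apply/word_classP/word_eq_mulVw.
Qed.

Lemma presented_mulrV :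
  right_inverse (word_class [::]) presented_inv presented_mul.
Proof.
elim/presented_ind=> u; rewrite word_class_winv word_class_cat.
by apply/word_classP/word_eq_mulwV.
Qed.

HB.instance Definition _ := isGroup.Build presented presented_mulA
  presented_mul1 presented_mulr1 presented_mulV presented_mulrV.

End Presentation.

(* The generators of nu H are the elements of the disjoint union H + H, with
   inl g standing for g and inr g for g^phi. The multiplication tables
   NuMulL and NuMulR carry all the relations of H and of its copy H^phi. *)

Section Nu.
Variable H : groupType.

Definition nu_base (g : H) : word (H + H) := [:: (inl g, true)].
Definition nu_copy (g : H) : word (H + H) := [:: (inr g, true)].

Inductive nu_rel : word (H + H) -> word (H + H) -> Prop :=
| NuMulL g h : nu_rel (nu_base g ++ nu_base h) (nu_base (g * h))
| NuMulR g h : nu_rel (nu_copy g ++ nu_copy h) (nu_copy (g * h))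
| NuConjL g1 g2 g3 :
    nu_rel (wconj (wcomm (nu_base g1) (nu_copy g2)) (nu_base g3))
           (wcomm (nu_base (g1 ^ g3)) (nu_copy (g2 ^ g3)))
| NuConjR g1 g2 g3 :
    nu_rel (wconj (wcomm (nu_base g1) (nu_copy g2)) (nu_copy g3))
           (wcomm (nu_base (g1 ^ g3)) (nu_copy (g2 ^ g3))).

Definition nu : groupType := presented nu_rel.

End Nu.

(* The exponent of an arbitrary group, with value 0 if no positive power
   kills the whole group. *)

Section GroupExponent.
Variable H : groupType.

Definition killing_exp : pred nat :=
  fun n => (0 < n)%N && `[< forall x : H, x ^+ n = 1 >].

Definition group_exponent : nat :=
  if pselect (exists n, killing_exp n) is left ex then ex_minn ex else 0.

Lemma dvdn_group_exponent n :
  group_exponent %| n <-> (forall x : H, x ^+ n = 1).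
Proof.
rewrite /group_exponent; case: pselect => [ex | nex].
  case: ex_minnP => e /andP[e_gt0 /asboolP eP] e_min; split=> [|nP].
    by case/dvdnP=> q -> x; rewrite mulnC expgnA eP expg1n.
  have remP (x : H) : x ^+ (n %% e) = 1.
    by move: (nP x); rewrite {1}(divn_eq n e) expgnDr mulnC expgnA eP expg1n
                             mul1g.
  rewrite /dvdn; case: posnP => // r_gt0.
  have /e_min : killing_exp (n %% e) by rewrite /killing_exp r_gt0; apply/asboolP.
  by rewrite leqNgt ltn_mod e_gt0.
split=> [|nP]; first by rewrite dvd0n => /eqP-> x; rewrite expg0.
rewrite dvd0n; case: posnP => // n_gt0.
by case: nex; exists n; rewrite /killing_exp n_gt0; apply/asboolP.
Qed.

End GroupExponent.

Lemma group_exponent_subg (gT : finGroupType) (G : {group gT}) :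
  group_exponent (subg_of G) = exponent G.
Proof.
apply/eqP; rewrite eqn_dvd; apply/andP; split.
  apply/dvdn_group_exponent=> x; apply: val_inj.
  by rewrite /= -[val]/(@sgval _ G) morphX ?inE // expg_exponent // subgP.
apply/exponentP=> x Gx; rewrite -[x](subgK x Gx) -morphX ?inE //.
have /dvdn_group_exponent-> := dvdnn (group_exponent (subg_of G)).
exact: morph1.
Qed.

Section PowerSubgroup.
Variable gT : finGroupType.
Implicit Type A : {set gT}.

Definition power_subgroup A k : {set gT} := <<[set x ^+ k | x in A]>>.

Definition potent (p : nat) A : bool :=
  p.-group A &&
  (if p == 2 then A^`(1) \subset power_subgroup A 4
   else 'L_(p - 1)(A) \subset power_subgroup A p).

End PowerSubgroup.

Definition bold_prime (p : nat) : nat := if p == 2 then 4 else p.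

(* Main.v *)
(* Let K be the normal closure of N and of its copy in nu(G). Any x in nu(G)
   satisfies x^m \in K for m = exp(nu(G / N)), so it is enough to bound exp(K).
   Conjugation on the tensor part [G, G^phi] factors through G, so that
   [k, v] lies in the normal closure K(M) of M and M^phi as soon as the three
   images of k under nu(G) -> G x G x G, g |-> (g, 1, g), g^phi |-> (1, g, g),
   lie in the normal subgroup M. Hence gamma_(i+1)(K(M)) <= K(gamma_i(M)).

   K(M) is generated by elements of order dividing exp(M). By the
   Hall-Petrescu formula a group generated by elements of order dividing p^a
   has exponent dividing p^a if gamma_(p^j) has exponent dividing p^(a-j) for
   all j > 0, and p^(a+1) if this holds for gamma_(p^j+1) instead. If
   gamma_p(N) = 1, then gamma_(p+1)(K) = 1 and the second criterion applies.
   If N is potent, iterate M |-> M^p (M^4 when p = 2), starting from N: the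
   lower central series of each term of the resulting chain M_0 > M_1 > ...
   descends through the next ones fast enough for the criteria to apply to all
   the K(M_i), by induction from the end of the chain. For odd p this gives
   exp(K) | exp(N) for every potent N, which covers (b). *)

From HB Require Import structures.
Require Import Defs.
From mathcomp Require Import all_boot all_fingroup all_solvable.
From mathcomp Require Import generic_quotient boolp zify.

Set Implicit Arguments.
Unset Strict Implicit.
Unset Printing Implicit Defensive.

Local Open Scope group_scope.

(** * The Hall-Petrescu formula and generators of bounded order *)

Ltac gsimpl :=
  rewrite /commg /conjg ?invgM ?invgK ?mulgA;
  do ?rewrite ?mulg1 ?mul1g ?mulgK ?mulgKV ?mulVg ?mulgV ?mulgA ?invg1.

Section Predicates.
Variable T : groupType.
Implicit Types (A B C H : T -> Prop) (x y z g : T).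

Definition subgroup H :=
  [/\ H 1, forall x y, H x -> H y -> H (x * y) & forall x, H x -> H x^-1].

Definition normalized A H := forall x g, A x -> H g -> A (x ^ g).

Definition commutes_into A B C := forall x y, A x -> B y -> C [~ x, y].

Inductive gen A : T -> Prop :=
| Gen x of A x : gen A x
| Gen1 : gen A 1
| GenM x y of gen A x & gen A y : gen A (x * y)
| GenV x of gen A x : gen A x^-1.

Lemma subgroup1 : subgroup (eq^~ (1 : T)).
Proof. by split=> // [_ _ -> ->|_ ->]; rewrite ?mulg1 ?invg1. Qed.

Lemma normalized1 H : normalized (eq^~ (1 : T)) H.
Proof. by move=> _ g -> _; rewrite conj1g. Qed.

Lemma subgroup_gen A : subgroup (gen A).
Proof. by split; [apply: Gen1 | apply: GenM | apply: GenV]. Qed.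

Lemma gen_min A H : subgroup H -> (forall x, A x -> H x) ->
  forall x, gen A x -> H x.
Proof. by case=> H1 HM HV AH x; elim=> {x}; auto. Qed.

Lemma normalized_gen A H : normalized A H -> normalized (gen A) H.
Proof.
move=> nAH x g gx Hg; elim: gx => {x} [x Ax||x y _ IHx _ IHy|x _ IHx].
- by apply/Gen/nAH.
- by rewrite conj1g; apply: Gen1.
- by rewrite conjMg; apply: GenM.
- by rewrite conjVg; apply: GenV.
Qed.

Lemma subgroupX H n x : subgroup H -> H x -> H (x ^+ n).
Proof.
case=> H1 HM _ Hx; elim: n => [|n IHn]; first by rewrite expg0.
by rewrite expgS; apply: HM.
Qed.

Lemma subgroup_conj H : subgroup H -> normalized H H.
Proof. by case=> _ HM HV x g Hx Hg; rewrite conjgE; auto. Qed.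

Lemma commgM_l x y z : [~ x * y, z] = [~ x, z] ^ y * [~ y, z].
Proof. by gsimpl. Qed.

Lemma commgM_r x y z : [~ x, y * z] = [~ x, z] * [~ x, y] ^ z.
Proof. by gsimpl. Qed.

Lemma commgV_l x y : [~ x^-1, y] = ([~ x, y]^-1) ^ x^-1.
Proof. by gsimpl. Qed.

Lemma commgV_r x y : [~ x, y^-1] = ([~ x, y]^-1) ^ y^-1.
Proof. by gsimpl. Qed.

Lemma commg_inv x y : [~ x, y]^-1 = [~ y, x].
Proof. by gsimpl. Qed.

Lemma commutes_gen H A B C :
    subgroup H -> subgroup C -> normalized C H ->
    (forall x, A x -> H x) -> (forall x, B x -> H x) ->
  commutes_into A B C -> commutes_into (gen A) (gen B) C.
Proof.
move=> sH sC nCH AH BH AB.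
have [C1 CM CV] := sC; have [H1 HM HV] := sH.
have gAH := gen_min sH AH; have gBH := gen_min sH BH.
have ABr x y : A x -> gen B y -> C [~ x, y].
  move=> Ax; elim=> {y} [y By||y z gy IHy gz IHz|y gy IHy].
  - exact: AB.
  - by rewrite commg1.
  - by rewrite commgM_r; apply: CM => //; apply: nCH => //; apply: gBH.
  - by rewrite commgV_r; apply: nCH; [apply: CV | apply/HV/gBH].
move=> x y gx gy; elim: gx => {x} [x Ax||x z gx IHx gz IHz|x gx IHx].
- exact: ABr.
- by rewrite comm1g.
- by rewrite commgM_l; apply: CM => //; apply: nCH => //; apply: gAH.
- by rewrite commgV_l; apply: nCH; [apply: CV | apply/HV/gAH].
Qed.

(* [lcs H n] is the term gamma_(n+1)(H) of the lower central series. *)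
Fixpoint lcs H n : T -> Prop :=
  if n is n'.+1 then
    gen (fun z => exists x y, [/\ lcs H n' x, H y & z = [~ x, y]])
  else H.

Section LowerCentralSeries.
Variable H : T -> Prop.
Hypothesis sH : subgroup H.

Lemma subgroup_lcs n : subgroup (lcs H n).
Proof. by case: n => [|n] //; apply: subgroup_gen. Qed.

Lemma lcs_normalized n : normalized (lcs H n) H.
Proof.
elim: n => [|n IHn]; first exact: subgroup_conj.
apply: normalized_gen => _ g [x [y [nx Hy ->]]] Hg; rewrite conjRg.
by exists (x ^ g), (y ^ g); split=> //; [apply: IHn | apply: subgroup_conj].
Qed.

Lemma lcs_decr n x : lcs H n.+1 x -> lcs H n x.
Proof.
apply: gen_min; first exact: subgroup_lcs.
have [_ nM nV] := subgroup_lcs n.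
move=> _ [y [z [ny Hz ->]]]; rewrite commgEl.
by apply: nM; [apply: nV | apply: lcs_normalized].
Qed.

Lemma lcs_leq m n x : m <= n -> lcs H n x -> lcs H m x.
Proof.
move=> /subnK <-; elim: (n - m)%N => // k IHk.
by rewrite addSn => /lcs_decr.
Qed.

Lemma lcs_sub n x : lcs H n x -> H x.
Proof. exact: (@lcs_leq 0). Qed.

Lemma lcs_commg_sub n x y : lcs H n x -> H y -> lcs H n.+1 [~ x, y].
Proof. by move=> nx Hy; apply: Gen; exists x, y. Qed.

(** Three-subgroup argument by induction on [j]. Wrapping [lcs H i] in [gen] lets [commutes_gen]
    reduce the second entry to a generator [[~ y, h]] of [lcs H j.+1]. *)
Lemma lcs_commg i j : commutes_into (lcs H i) (lcs H j) (lcs H (i + j).+1).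
Proof.
have [_ _ HV] := sH.
elim: j i => [|j IHj] i.
  by move=> x y ix Hy; rewrite addn0; apply: lcs_commg_sub.
suff c : commutes_into (gen (lcs H i)) (lcs H j.+1) (lcs H (i + j.+1).+1).
  by move=> x y ix; apply: c; apply: Gen.
have [C1 CM CV] := subgroup_lcs (i + j.+1).+1.
have nC := @lcs_normalized (i + j.+1).+1.
apply: (commutes_gen sH) => //; first exact: lcs_sub.
  by move=> _ [y [h [jy Hh ->]]]; apply/(@lcs_sub j.+1)/lcs_commg_sub.
move=> x _ ix [y [h [jy Hh ->]]]; rewrite -commg_inv; apply: (CV).
have Hx := lcs_sub ix; have Hy := lcs_sub jy.
have [_ _ iV] := subgroup_lcs i; have [_ _ jV] := subgroup_lcs j.
(* The Hall-Witt identity for [x], [y] and [h^-1]. *)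
have -> : [~ y, h, x] =
    (([~ h^-1, x^-1, y] ^ x) ^ h * ([~ x, y^-1, h^-1] ^ y) ^ h)^-1.
  by gsimpl.
apply: (CV); apply: (CM); do 2![apply: (nC) => //]; last first.
  rewrite addnS; apply: lcs_commg_sub; last exact: HV.
  by apply: IHj => //; apply: jV.
rewrite addnS -addSn; apply: IHj => //; rewrite -commg_inv.
have [_ _ V] := subgroup_lcs i.+1; apply: V; apply: lcs_commg_sub; auto.
Qed.

End LowerCentralSeries.

(** * N-series and polynomial sequences with values in them *)

Definition nseries (F : nat -> T -> Prop) :=
  [/\ forall k, subgroup (F k), forall k x, F k.+1 x -> F k x
    & forall i j, commutes_into (F i) (F j) (F (i + j)%N)].

Lemma nseries_leq F i j x : nseries F -> i <= j -> F j x -> F i x.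
Proof.
case=> _ Fd _ /subnK <-; elim: (j - i)%N => // k IHk.
by rewrite addSn => /Fd.
Qed.

Section PolynomialSequences.
Variable F : nat -> T -> Prop.
Hypothesis nF : nseries F.
Implicit Types s t u : nat -> T.

Let F1 k : F k 1. Proof. by case: nF => /(_ k)[]. Qed.
Let FM k x y : F k x -> F k y -> F k (x * y).
Proof. by case: nF => /(_ k)[_ fM _] _ _; apply: fM. Qed.
Let FV k x : F k x -> F k x^-1.
Proof. by case: nF => /(_ k)[_ _ fV] _ _; apply: fV. Qed.
Let FR i j x y : F i x -> F j y -> F (i + j)%N [~ x, y].
Proof. by case: nF => _ _ fR; apply: fR. Qed.

Definition gdiff s : nat -> T := fun n => (s n)^-1 * s n.+1.

(* Only the first [d] differences are tested, so that closure under products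
   and commutators can be proved by induction on [d]. *)
Fixpoint poly d k s : Prop :=
  (forall n, F k (s n)) /\
  (if d is d'.+1 then poly d' k.+1 (gdiff s) else True).

Lemma poly_val d k s n : poly d k s -> F k (s n).
Proof. by case: d => [|d] []. Qed.

Lemma eq_poly d k s t : s =1 t -> poly d k s -> poly d k t.
Proof.
elim: d k s t => [|d IHd] k s t st [Fs ps]; split=> //;
  try by move=> n; rewrite -st.
by apply: IHd ps => n; rewrite /gdiff !st.
Qed.

Lemma poly_level d k l s : k <= l -> poly d l s -> poly d k s.
Proof.
have Fk j z : j >= k -> F j z -> F k z by apply: nseries_leq.
elim: d k l s Fk => [|d IHd] k l s Fk kl [Fs ps]; split=> //; eauto.
by apply: IHd ps => // j z kj; apply: nseries_leq.
Qed.

Lemma poly_depth d k s : poly d.+1 k s -> poly d k s.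
Proof.
elim: d k s => [|d IHd] k s [Fs ps]; split=> //.
exact: IHd.
Qed.

Lemma poly1 d k : poly d k (fun=> 1).
Proof.
elim: d k => [|d IHd] k; split=> //.
by apply: eq_poly (IHd k.+1) => n; rewrite /gdiff invg1 mulg1.
Qed.

(** Lazard-Leibman theorem: polynomial sequences form a group. The closures are proved together
    because the difference of a product contains a conjugate, hence a commutator, and that of a
    commutator contains products. *)
Lemma poly_closed d :
  [/\ forall k s t, poly d k s -> poly d k t -> poly d k (fun n => s n * t n),
      forall k s, poly d k s -> poly d k (fun n => (s n)^-1)
    & forall i j s t, poly d i s -> poly d j t ->
      poly d (i + j) (fun n => [~ s n, t n])].
Proof.
elim: d => [|d [IHM IHV IHR]].
  split=> [k s t [Fs _] [Ft _]|k s [Fs _]|i j s t [Fs _] [Ft _]]; split=> // n.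
  - exact: FM.
  - exact: FV.
  - exact: FR.
have IHJ k l s t : poly d k s -> poly d l t -> poly d k (fun n => s n ^ t n).
  move=> ps pt; apply: (@eq_poly _ _ (fun n => s n * [~ s n, t n])).
    by move=> n; rewrite commgEl mulKVg.
  by apply: IHM => //; apply: poly_level (IHR _ _ _ _ ps pt); apply: leq_addr.
split=> [k s t ps pt|k s ps|i j s t ps pt]; split=> [n|].
- by apply: FM; apply: poly_val; eassumption.
- have [_ qs] := ps; have [_ qt] := pt; have {}pt := poly_depth pt.
  apply: (@eq_poly _ _ (fun n => gdiff s n ^ t n * gdiff t n)).
    by move=> n; rewrite /gdiff; gsimpl.
  by apply: IHM => //; apply: IHJ pt.
- by apply: FV; apply: poly_val ps.
- have [_ qs] := ps; have {}ps := poly_depth ps.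
  apply: (@eq_poly _ _ (fun n => (gdiff s n)^-1 ^ (s n)^-1)).
    by move=> n; rewrite /gdiff; gsimpl.
  by apply: (@IHJ _ k); apply: IHV.
- by apply: FR; apply: poly_val; eassumption.
have [_ qs] := ps; have [_ qt] := pt.
have {}ps := poly_depth ps; have {}pt := poly_depth pt.
(* Expanding the commutator of the shifted sequences splits the difference of [w] into three
   factors, each one level deeper than [w]; for [[~ w n, r n]] this holds because both differences
   in [r] have level at least 1. *)
pose w n := [~ s n, t n]; pose r n := gdiff t n * gdiff s n.
pose t' n := t n * gdiff t n.
apply: (@eq_poly _ _ (fun n => ([~ s n, gdiff t n] ^ gdiff s n) ^ w n *
     [~ w n, r n] * [~ gdiff s n, t' n])).
  by move=> n; rewrite /gdiff /w /r /t' /gdiff; gsimpl.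
have pw : poly d (i + j) w by apply: IHR.
have pr : poly d 1 r.
  by apply: IHM; [apply: poly_level qt | apply: poly_level qs].
have pt' : poly d j t' by apply: IHM => //; apply: poly_level qt.
apply: (IHM); first apply: (IHM).
- apply: (IHJ _ _ _ _ _ pw); apply: (IHJ _ _ _ _ _ qs).
  by rewrite -addnS; apply: IHR.
- by rewrite -addn1; apply: IHR.
- by rewrite -addSn; apply: IHR.
Qed.

Lemma polyM d k s t :
  poly d k s -> poly d k t -> poly d k (fun n => s n * t n).
Proof. by case: (poly_closed d) => + _ _; apply. Qed.

Lemma polyV d k s : poly d k s -> poly d k (fun n => (s n)^-1).
Proof. by case: (poly_closed d) => _ + _; apply. Qed.

(** By Pascal's rule the difference of [x ^+ 'C(n, k.+1)] is [x ^+ 'C(n, k)]: each difference lowers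
    [k] by one and gains one level. *)
Lemma poly_bin d j k x : F (j + k)%N x -> poly d j (fun n => x ^+ 'C(n, k)).
Proof.
have FX i y n : F i y -> F i (y ^+ n).
  by case: nF => /(_ i) sF _ _; apply: subgroupX.
elim: d j k x => [|d IHd] j k x Fx.
  by split=> // n; apply: FX; apply: nseries_leq Fx; rewrite ?leq_addr.
split=> [n|]; first by apply: FX; apply: nseries_leq Fx; rewrite ?leq_addr.
case: k Fx => [|k] Fx.
  by apply: eq_poly (poly1 d j.+1) => n; rewrite /gdiff !bin0 mulVg.
rewrite addnS -addSn in Fx; apply: eq_poly (IHd _ _ _ Fx) => n.
by rewrite /gdiff binS expgnDr mulKg.
Qed.

(** The difference of [s] vanishes below [k - 1] and equals [s k] there, so [s k] is the [k]-th
    iterated difference at 0, that is, a Taylor coefficient. *)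
Lemma poly_vanish d j k s : k <= d -> poly d j s ->
  (forall n, n < k -> s n = 1) -> F (j + k)%N (s k).
Proof.
elim: k d j s => [|k IHk] d j s kd ps s1.
  by rewrite addn0; apply: poly_val ps.
case: d kd ps => // d kd [_ ps].
rewrite -addSnnS; have := IHk _ _ _ kd ps; rewrite /gdiff.
rewrite s1 // invg1 mul1g; apply=> n nk; rewrite !s1 ?invg1 ?mulg1 //.
exact: leqW.
Qed.

(* Only the instance of the Taylor expansion needed below: a polynomial
   sequence is, at [P], a product of powers of its Taylor coefficients. *)
Lemma poly_subgroup W P s : subgroup W -> (forall d, poly d 0 s) ->
    s 0 = 1 -> s 1%N = 1 ->
    (forall k z, 1 < k <= P -> F k z -> W (z ^+ 'C(P, k))) ->
  W (s P).
Proof.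
move=> [W1 WM WV] ps s0 s1 FW; case: (leqP 2 P) => [P2|]; last first.
  by case: P {FW} => [|[|]] // _; rewrite ?s0 ?s1.
(* Taylor coefficients are divided out one at a time: [t] is what remains after those below [m.+2],
   and for [m = P.-1] it is trivial at [P]. *)
suff /(_ (P.-1)%N): forall m, m.+2 <= P.+1 ->
    exists t, [/\ forall d, poly d 0 t, forall n, n < m.+2 -> t n = 1
                & W (t P) -> W (s P)].
  case=> [|t [_ t1 tW]]; first by lia.
  by apply: tW; rewrite t1 //; lia.
elim=> [_|m IHm mP]; first by exists s; split=> // -[|[|]].
have [|t [pt t1 tW]] := IHm; first by lia.
have Ft : F m.+2 (t m.+2) by apply: (poly_vanish (leqnn _) (pt _)).
exists (fun n => (t m.+2 ^+ 'C(n, m.+2))^-1 * t n); split=> [d|n nm|Wt].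
- by apply: polyM (pt d); apply/polyV/poly_bin.
- move: nm; rewrite ltnS leq_eqVlt => /predU1P[->|nm].
    by rewrite binn expg1 mulVg.
  by rewrite bin_small // expg0 invg1 mul1g t1.
apply: tW; rewrite -[t P](mulKVg (t m.+2 ^+ 'C(P, m.+2))).
by apply: WM => //; apply: FW => //; lia.
Qed.

(** The sequence [(x * y) ^- n * (x ^+ n * y ^+ n)] is polynomial and trivial at 0 and 1, so its
    Taylor expansion starts with [k = 2]. *)
Theorem Hall_Petrescu W P x y : subgroup W -> F 1%N x -> F 1%N y ->
    (forall k z, 1 < k <= P -> F k z -> W (z ^+ 'C(P, k))) ->
  W ((x * y) ^- P * (x ^+ P * y ^+ P)).
Proof.
move=> sW Fx Fy FW.
have pX z d : F 1%N z -> poly d 0 (fun n => z ^+ n).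
  by move=> Fz; apply: eq_poly (@poly_bin d 0 1 z Fz) => n; rewrite bin1.
apply: (@poly_subgroup W P
          (fun n => (x * y) ^- n * (x ^+ n * y ^+ n))) => // [d||].
- by apply: polyM; [apply/polyV/pX/FM | apply: polyM; apply: pX].
- by rewrite !expg0 invg1 !mul1g.
- by rewrite !expg1 mulVg.
Qed.

End PolynomialSequences.

(** Here [j] is the [p]-adic valuation of [k], and the divisibility comes from [k * 'C(p ^ a, k) = p
    ^ a * 'C(p ^ a - 1, k - 1)]. *)
Lemma dvdn_bin_expn p a k : prime p -> 0 < k <= p ^ a ->
  exists j, [/\ j <= a, p ^ j <= k & p ^ (a - j) %| 'C(p ^ a, k)].
Proof.
move=> pr_p /andP[k0 ka]; have p1 := prime_gt1 pr_p.
have jk : p ^ logn p k <= k by apply: dvdn_leq => //; apply: pfactor_dvdnn.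
exists (logn p k); split=> //.
  by rewrite -(leq_exp2l _ _ p1); apply: leq_trans ka.
have C0 : 0 < 'C(p ^ a, k) by rewrite bin_gt0.
rewrite pfactor_dvdn // leq_subLR -lognM // -pfactor_dvdn //; last first.
  by rewrite muln_gt0 k0.
case: k k0 {ka jk C0} => // k _.
by rewrite -mul_bin_diag dvdn_mulr.
Qed.

Lemma nseries_lcs H : subgroup H -> nseries (fun k => lcs H k.-1).
Proof.
move=> sH; split=> [k|k x|i j x y Fx Fy]; first exact: subgroup_lcs.
  by apply: lcs_leq => //; lia.
have := lcs_commg sH Fx Fy; apply: lcs_leq => //.
by case: i j {Fx Fy} => [|i] [|j]; lia.
Qed.

(** Since [x * [~ x, y] = x ^ y], the Hall-Petrescu formula for [x] and [[~ x, y]] compares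
    [(x ^+ q) ^ y] with [x ^+ q * [~ x, y] ^+ q]. *)
Lemma commXg_subgroup W q x y : subgroup W ->
    (forall k z, 1 < k <= q ->
       lcs (gen (fun z => z = x \/ z = [~ x, y])) k.-1 z ->
       W (z ^+ 'C(q, k))) ->
    W ([~ x, y] ^+ q) ->
  W [~ x ^+ q, y].
Proof.
move=> sW LW Wc; have [_ WM WV] := sW.
have /nseries_lcs nF := subgroup_gen (fun z => z = x \/ z = [~ x, y]).
have := Hall_Petrescu nF sW (y := [~ x, y]) _ _ LW.
move=> /(_ x) Wu.
have {}Wu : W ((x * [~ x, y]) ^- q * (x ^+ q * [~ x, y] ^+ q)).
  by apply: Wu; apply: Gen; [left | right].
have {}Wu : W ((x * [~ x, y]) ^- q * x ^+ q).
  by have := WM _ _ Wu (WV _ Wc); rewrite mulgA mulgK.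
have := WV _ Wu; rewrite invgM invgK.
by rewrite commgEl mulKVg -conjXg -commgEl.
Qed.

(** * Exponents of groups generated by elements of bounded prime-power order *)

Section PrimePowers.
Variables (p : nat) (W : T -> Prop).
Hypotheses (pr_p : prime p) (sW : subgroup W).

Lemma expg_dvdn_subgroup n m x : n %| m -> W (x ^+ n) -> W (x ^+ m).
Proof. by case/dvdnP=> q ->; rewrite mulnC expgnA; apply: subgroupX. Qed.

Lemma expgM_subgroup F a x y : nseries F ->
    (forall j k z, j <= a -> 1 < k -> p ^ j <= k -> F k z ->
       W (z ^+ (p ^ (a - j)))) ->
    F 1%N x -> F 1%N y -> W (x ^+ (p ^ a)) -> W (y ^+ (p ^ a)) ->
  W ((x * y) ^+ (p ^ a)).
Proof.
move=> nF FW Fx Fy Wx Wy; have [_ WM WV] := sW.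
suff Wu : W ((x * y) ^- (p ^ a) * (x ^+ (p ^ a) * y ^+ (p ^ a))).
  move: Wu (WM _ _ Wx Wy); move: (_ * y ^+ _) ((x * y) ^+ _) => u v /WV + Wu.
  by rewrite invgM invgK => /(WM _ _ Wu); rewrite mulKVg.
apply: (Hall_Petrescu nF) => // k z /andP[k1 kP] Fz.
have [|j [ja jk dvd]] := dvdn_bin_expn pr_p (a := a) (k := k).
  by rewrite kP (ltn_trans _ k1).
by apply: expg_dvdn_subgroup dvd _; apply: FW Fz.
Qed.

(** The value [t = 0] gives the criterion with [gamma_(p^j)], and [t = 1] the one with
    [gamma_(p^j+1)]. *)
Variables (a t : nat) (H S : T -> Prop).
Hypotheses (t1 : t <= 1) (sH : subgroup H) (nWH : normalized W H).
Hypotheses (SH : forall x, S x -> H x) (HS : forall x, H x -> gen S x).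
Hypothesis (SW : forall x, S x -> W (x ^+ (p ^ a))).
Hypothesis lcsW : forall j z, 0 < j <= a -> lcs H (p ^ j - 1 + t) z ->
  W (z ^+ (p ^ (a - j))).

(** The [k]-th term is [gamma_(k(i+1))(H)], and [H] for [k = 0] since subtraction truncates. It
    serves for products inside [gamma_(i+1)(H)]. *)
Let nserieslcs i : nseries (fun k => lcs H (k * i.+1 - 1)).
Proof.
split=> [k|k x|j k x y Fx Fy]; first exact: subgroup_lcs.
  by apply: lcs_leq => //; lia.
have := lcs_commg sH Fx Fy; apply: lcs_leq => //.
case: j k {Fx Fy} => [|j] [|k]; lia.
Qed.

Let cycle_lcs x i := gen (fun z => z = x \/ lcs H i z).

Let nseries_cycle_lcs x i : H x ->
  nseries (fun k => if k is k'.+2 then lcs H (i + k'.+1) else cycle_lcs x i).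
Proof.
move=> Hx; have sC : subgroup (cycle_lcs x i) by apply: subgroup_gen.
have CH z : cycle_lcs x i z -> H z.
  by apply: gen_min => // {}z [->|/lcs_sub]; auto.
have sL := subgroup_lcs sH.
have R1 n z y : lcs H n z -> cycle_lcs x i y -> lcs H n.+1 [~ z, y].
  by move=> Hz /CH; apply: lcs_commg_sub.
have R2 n z y : cycle_lcs x i y -> lcs H n z -> lcs H n.+1 [~ y, z].
  by move=> Cy Hz; rewrite -commg_inv; case: (sL n.+1) => _ _; apply; apply: R1.
(* As [x] commutes with itself, every other commutator of generators has an entry in [lcs H i], so
   it falls into [lcs H i.+1]. *)
have R : commutes_into (cycle_lcs x i) (cycle_lcs x i) (lcs H i.+1).
  apply: (commutes_gen sH) => //; try by move=> z [->|/lcs_sub]; auto.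
    exact: lcs_normalized.
  move=> z y [->|Hz] [->|Hy].
  - by rewrite commgg; case: (sL i.+1).
  - by apply: R2 => //; apply: Gen; left.
  - by apply: R1 => //; apply: Gen; left.
  - by apply: R1 => //; apply: Gen; right.
have CR z y : cycle_lcs x i z -> cycle_lcs x i y -> cycle_lcs x i [~ z, y].
  have [_ CM CV] := sC => Cz Cy; rewrite commgEl.
  by apply: CM; [apply: CV | apply: subgroup_conj].
split=> [[|[|k]]|[|[|k]] z|[|[|j]] [|[|k]] z y Fz Fy] //; rewrite ?add0n ?addn0.
- by move=> Hz; apply: Gen; right; apply: lcs_leq Hz => //; lia.
- by apply: lcs_leq => //; lia.
- exact: CR.
- exact: CR.
- by apply: lcs_leq (R2 _ _ _ Fz Fy) => //; lia.
- exact: CR.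
- by change (lcs H (i + 1) [~ z, y]); rewrite addn1; apply: R.
- by apply: lcs_leq (R2 _ _ _ Fz Fy) => //; lia.
- by apply: lcs_leq (R1 _ _ _ Fz Fy) => //; lia.
- by rewrite addn1; apply: lcs_leq (R1 _ _ _ Fz Fy) => //; lia.
- by rewrite !addSn; apply: lcs_leq (lcs_commg sH Fz Fy) => //; lia.
Qed.

(* By descending induction on [i]: gamma_(i+1)(H) is generated by commutators
   [x, s] = (s^x)^-1 s with [s] in [S], whose two factors are killed modulo [W];
   they lie in the first term of <s> gamma_(i+1) > gamma_(i+2) > ..., which is
   an N-series, so the Hall-Petrescu formula applies. *)
Theorem lcs_exponent i z : t <= i -> lcs H i z -> W (z ^+ (p ^ a)).
Proof.
have [W1 WM WV] := sW; have [H1 HM HV] := sH; have p1 := prime_gt1 pr_p.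
(* For [a = 0] the generators already lie in [W]; for [a > 0] the case [j = 1] of [lcsW] starts the
   induction at [i >= p - 1 + t]. *)
have [a0|a0] := posnP a.
  move=> _ /lcs_sub-/(_ sH) /HS.
  rewrite a0 expn0 expg1; elim=> {z} [x Sx||x y _ Wx _ Wy|x _ Wx]; auto.
  by have := SW Sx; rewrite a0.
suff /(_ (p - 1 + t - i)%N i z): forall d i z, p - 1 + t <= i + d ->
    t <= i -> lcs H i z -> W (z ^+ (p ^ a)).
  by apply; lia.
elim=> {i z} [|d IHd] i z id ti Hz.
  apply: (@expg_dvdn_subgroup (p ^ (a - 1))).
    by rewrite dvdn_exp2l ?leq_subr.
  by apply: lcsW; rewrite ?a0 // expn1; apply: lcs_leq Hz => //; lia.
have {}IHd x : lcs H i.+1 x -> W (x ^+ (p ^ a)) by apply: IHd; lia.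
have [L1 LM LV] := subgroup_lcs sH i.
(* The elements of [gamma_(i+1)(H)] killed modulo [W] form a subgroup normalized by [H], so it is
   enough to treat generators. *)
pose G x := lcs H i x /\ W (x ^+ (p ^ a)).
have GM x y : G x -> G y -> G (x * y).
  case=> Hx Wx [Hy Wy]; split; first exact: LM.
  apply: (expgM_subgroup (nserieslcs i)) => //; last first.
  - by rewrite mul1n subn1.
  - by rewrite mul1n subn1.
  move=> [|j] k w ja k1 jk Fz.
    by rewrite subn0; apply: IHd; apply: lcs_leq Fz => //; nia.
  by apply: lcsW => //; apply: lcs_leq Fz => //; nia.
have GV x : G x -> G x^-1.
  by case=> Hx Wx; split; [apply: LV | rewrite expVgn; apply: WV].
have GJ x y : G x -> H y -> G (x ^ y).
  case=> Hx Wx Hy; split; first exact: lcs_normalized.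
  by rewrite -conjXg; apply: nWH.
have G1 : G 1 by split; rewrite ?expg1n.
suff [] : G z by [].
case: i ti Hz {id} @G GM GV GJ G1 IHd L1 LM LV
  => [|i] ti Hz G GM GV GJ G1 IHd L1 LM LV.
  elim: (HS Hz) => {z Hz} [x Sx||x y _ Wx _ Wy|x _ Wx]; auto.
  by split; [apply: SH | apply: SW].
move: Hz; apply: gen_min => // {z} _ [x [y [Hx Hy ->]]].
elim: {Hy}(HS Hy) => {y} [s Ss||y y' _ Gy gy' Gy'|y gy Gy].
- have Hs := SH Ss; have Hxs := lcs_commg_sub Hx Hs.
  have HX := lcs_sub sH Hx; split=> //; rewrite commgEr.
  apply: (expgM_subgroup (nseries_cycle_lcs i.+1 Hs)).
  + move=> [|j] [|[|k]] // w ja _ jk Fz.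
      by rewrite subn0; apply: IHd; apply: lcs_leq Fz => //; lia.
    by apply: lcsW => //; apply: lcs_leq Fz => //; lia.
  + rewrite conjVg; apply: GenV; rewrite -[s ^ x](mulKVg s) -commgEl.
    apply: GenM; apply: Gen; [by left | right].
    by rewrite -commg_inv; apply: LV.
  + by apply: Gen; left.
  + by rewrite -conjXg expVgn; apply: nWH => //; apply/WV/SW.
  + exact: SW.
- by rewrite commg1.
- rewrite commgM_r; apply: GM => //; apply: GJ => //.
  exact: gen_min gy'.
- rewrite commgV_r; apply: GJ; first exact: GV.
  by apply: HV; apply: gen_min gy.
Qed.

End PrimePowers.

Lemma gen_exponent p a H S : prime p -> subgroup H -> (forall x, S x -> H x) ->
    (forall x, H x -> gen S x) -> (forall x, S x -> x ^+ (p ^ a) = 1) ->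
    (forall j z, 0 < j <= a -> lcs H (p ^ j - 1) z -> z ^+ (p ^ (a - j)) = 1) ->
  forall x, H x -> x ^+ (p ^ a) = 1.
Proof.
move=> pr_p sH SH HS S1 L1 x Hx.
apply: (lcs_exponent pr_p subgroup1 (t := 0) _ sH _ SH HS S1 _ (i := 0)) => //.
  exact: normalized1.
by move=> j z; rewrite addn0; apply: L1.
Qed.

(** The case [t = 1] bounds the exponent of [gamma_2(H)] by [p ^ a]. Then [gen_exponent] applies
    with [a.+1]: [j = 1] uses [gamma_p <= gamma_2], and a larger [j] uses the hypothesis for
    [j - 1]. *)
Lemma gen_exponentS p a H S : prime p -> subgroup H -> (forall x, S x -> H x) ->
    (forall x, H x -> gen S x) -> (forall x, S x -> x ^+ (p ^ a) = 1) ->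
    (forall j z, 0 < j <= a -> lcs H (p ^ j) z -> z ^+ (p ^ (a - j)) = 1) ->
  forall x, H x -> x ^+ (p ^ a.+1) = 1.
Proof.
move=> pr_p sH SH HS S1 L1; have p1 := prime_gt1 pr_p.
have L2 z : lcs H 1 z -> z ^+ (p ^ a) = 1.
  apply: (lcs_exponent pr_p subgroup1 (t := 1) _ sH (@normalized1 H)
            SH HS S1) => //.
  move=> j {}z ja; rewrite subnK ?expn_gt0 ?prime_gt0 //; exact: L1.
apply: (gen_exponent pr_p sH SH HS) => [x Sx|[|[|j]] // z ja Hz].
- by rewrite expnSr expgnA S1 // expg1n.
- rewrite subSS subn0; apply: L2; apply: lcs_leq Hz => //.
  by rewrite expn1; lia.
- rewrite subSS; apply: L1 => //; apply: lcs_leq Hz => //.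
  rewrite (expnS p j.+1); have : 0 < p ^ j.+1 by rewrite expn_gt0 prime_gt0.
  nia.
Qed.

End Predicates.

(** * Homomorphisms and lower central series *)

Section Morphisms.
Variables (T U : groupType) (f : T -> U).
Hypothesis fM : {morph f : x y / x * y}.

Lemma morph_id1 : f 1 = 1.
Proof. by apply: (mulgI (f 1)); rewrite -fM !mulg1. Qed.

Lemma morph_inv x : f x^-1 = (f x)^-1.
Proof. by apply: (mulgI (f x)); rewrite -fM !mulgV morph_id1. Qed.

Lemma morph_conj x y : f (x ^ y) = f x ^ f y.
Proof. by rewrite !conjgE !fM morph_inv. Qed.

Lemma morph_comm x y : f [~ x, y] = [~ f x, f y].
Proof. by rewrite !commgEl fM morph_inv morph_conj. Qed.

Lemma gen_morph (A : T -> Prop) (H : U -> Prop) : subgroup H ->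
  (forall x, A x -> H (f x)) -> forall x, gen A x -> H (f x).
Proof.
move=> [H1 HM HV] AH x; elim=> {x} [x||x y _ Hx _ Hy|x _ Hx]; auto.
- by rewrite morph_id1.
- by rewrite fM; apply: HM.
- by rewrite morph_inv; apply: HV.
Qed.

Lemma lcs_morph (H : T -> Prop) (K : U -> Prop) n : subgroup K ->
  (forall x, H x -> K (f x)) -> forall x, lcs H n x -> lcs K n (f x).
Proof.
move=> sK HK; elim: n => // n IHn.
apply: gen_morph; first exact: subgroup_lcs.
move=> _ [x [y [/IHn Kx /HK Ky ->]]]; rewrite morph_comm.
exact: lcs_commg_sub.
Qed.

End Morphisms.

(** * Power subgroups of potent p-groups *)

Section FinitePGroups.
Variable gT : finGroupType.
Implicit Types (M N L X Y W : {group gT}) (x y z : gT).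

Canonical power_subgroup_group (A : {set gT}) k :=
  [group of power_subgroup A k].

Lemma mem_power_subgroup (A : {set gT}) k x :
  x \in A -> x ^+ k \in power_subgroup A k.
Proof. by move=> Ax; apply/mem_gen/imset_f. Qed.

Lemma power_subgroupS (A B : {set gT}) k :
  A \subset B -> power_subgroup A k \subset power_subgroup B k.
Proof. by move=> AB; apply/genS/imsetS. Qed.

Lemma power_subgroup_sub M k : power_subgroup M k \subset M.
Proof.
by rewrite gen_subG; apply/subsetP=> _ /imsetP[x Mx ->]; apply: groupX.
Qed.

Lemma power_subgroup_char M k : power_subgroup M k \char M.
Proof.
apply/charP; split=> [|f injf fM]; first exact: power_subgroup_sub.
rewrite morphim_gen; last first.
  by apply/subsetP=> _ /imsetP[x Mx ->]; apply: groupX.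
congr <<_>>; rewrite -[in RHS]fM; apply/setP=> y; apply/morphimP/imsetP.
  case=> _ _ /imsetP[x Mx ->] ->; exists (f x); first exact: mem_morphim.
  by rewrite morphX.
case=> _ /morphimP[x _ Mx ->] ->; exists (x ^+ k); rewrite ?groupX ?morphX //.
exact: imset_f.
Qed.

Lemma subgroup_mem L : subgroup (fun z => z \in L).
Proof.
by split=> [|x y|x]; [exact: group1 | exact: groupM | rewrite groupV].
Qed.

Lemma mem_genP (A : {set gT}) x : x \in <<A>> -> gen (fun z => z \in A) x.
Proof.
case/gen_prodgP=> n [c Ac ->].
elim/big_rec: _ => [|i y _ gy]; first exact: Gen1.
by apply: GenM => //; apply: Gen.
Qed.

Fixpoint icomm M N i : {group gT} :=
  if i is i'.+1 then [~: icomm M N i', N]%G else M.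

Lemma icommD M N i j : icomm (icomm M N i) N j = icomm M N (i + j).
Proof. by elim: j => [|j IHj]; rewrite ?addn0 ?addnS //= IHj. Qed.

Lemma icommS M L N i : M \subset L -> icomm M N i \subset icomm L N i.
Proof. by move=> ML; elim: i => //= i; apply: commSg. Qed.

Lemma icomm_normal M N i : M <| N -> icomm M N i <| N.
Proof.
move=> nMN; elim: i => //= i /andP[sIN nIN].
rewrite /normal commg_normr (subset_trans (commg_sub _ _)) //.
by rewrite join_subG sIN subxx.
Qed.

Lemma icomm_leq M N i j : M <| N -> i <= j -> icomm M N j \subset icomm M N i.
Proof.
move=> nMN /subnKC <-; rewrite -icommD; elim: (j - i)%N => //= k.
apply: subset_trans; rewrite commg_subl.
have nI := icomm_normal i nMN.
by case/andP: (icomm_normal k nI).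
Qed.

Lemma icommY M L N i : M <| N -> L <| N ->
  icomm (M <*> L) N i \subset icomm M N i <*> icomm L N i.
Proof.
move=> nM nL; elim: i => //= i IHi.
have nMi := icomm_normal i.+1 nM; have [sLi _] := andP (icomm_normal i nL).
have [sMi _] := andP (icomm_normal i nM).
apply: subset_trans (commSg _ IHi) _.
rewrite norm_joinEr; last first.
  by apply: subset_trans sLi _; case/andP: (icomm_normal i nM).
rewrite commMG; last by apply: subset_trans sLi _; case/andP: nMi.
by rewrite mul_subG ?joing_subl ?joing_subr.
Qed.

Lemma commg_subP (A : {set gT}) N W : A \subset N -> N \subset 'N(W) ->
  {in A & N, forall x y, [~ x, y] \in W} -> [~: <<A>>, N] \subset W.
Proof.
move=> sAN nWN AW; have sgN : <<A>> \subset N by rewrite gen_subG.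
rewrite -quotient_cents2 ?(subset_trans sgN) //.
rewrite quotient_gen ?(subset_trans sAN) // gen_subG.
apply: quotient_cents2r; rewrite gen_subG.
by apply/subsetP=> _ /imset2P[x y Ax Ny ->]; apply: AW.
Qed.

Lemma lcs_icomm N (M : {group gT}) (H : gT -> Prop) n z : M <| N ->
  (forall x, H x -> x \in M) -> lcs H n z -> z \in icomm M N n.
Proof.
move=> /andP[sMN _] HM; elim: n z => [|n IHn] /=; first exact: HM.
apply: gen_min; first exact: subgroup_mem.
move=> _ [x [y [/IHn Ix /HM My ->]]]; apply: mem_commg => //.
exact: (subsetP sMN).
Qed.

(** A modulus for showing [X <= Y]: when [X] is normal in the [p]-group [N], it contains the [p]-th
    powers of elements of [X] and the commutators of [X] with [N]. *)
Definition frattini_ext X Y N : {group gT} := (Y <*> ('Phi(X) <*> [~: X, N]))%G.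

Lemma frattini_ext_normal X Y N : X <| N -> Y <| N -> frattini_ext X Y N <| N.
Proof.
move=> nX nY; rewrite /frattini_ext /=; apply: normalY => //; apply: normalY.
  by apply: char_normal_trans (Phi_char _) nX.
exact: (icomm_normal 1 nX).
Qed.

(* In the quotient by [Y] the image of [X] is [Phi(X) [X, N]], hence [[X, N]],
   and this forces it to be trivial since [N] is nilpotent. *)
Lemma sub_frattini_ext (p : nat) X Y N : p.-group N -> X <| N -> Y <| N ->
  X \subset frattini_ext X Y N -> X \subset Y.
Proof.
move=> pN /andP[sXN nXN] /andP[sYN nYN] sXW.
have nYX := subset_trans sXN nYN.
rewrite -quotient_sub1 //; apply/trivgP; set Q := (X / Y)%G.
have pX : p.-group X := pgroupS sXN pN.
have sRX : [~: X, N] \subset X by rewrite commg_subl.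
have nYPhi := subset_trans (Phi_sub X) nYX.
have nYR := subset_trans sRX nYX.
have eQ : 'Phi(Q) <*> [~: Q, N / Y] = Q.
  apply/eqP; rewrite eqEsubset join_subG Phi_sub commg_subl quotient_norms //=.
  have := quotientS Y sXW; rewrite /= quotientY ?normG ?join_subG ?nYPhi //.
  rewrite trivg_quotient joing1G /= quotientY // quotientR //.
  by rewrite (quotient_Phi pX nYX).
have := Phi_nongen eQ; rewrite genGid => {}eQ.
have nilN : nilpotent (N / Y) by apply/quotient_nil/(pgroup_nil pN).
have := forallP nilN Q; rewrite subsetI (quotientS Y sXN) /= eQ subxx /=.
by move/eqP.
Qed.

Lemma power_subgroup_normal M N k : M <| N -> power_subgroup M k <| N.
Proof. exact/char_normal_trans/power_subgroup_char. Qed.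

Lemma commg_power_subgroup_sub M N W q : M \subset N -> N \subset 'N(W) ->
    {in M & N, forall x y, [~ x ^+ q, y] \in W} ->
  [~: power_subgroup M q, N] \subset W.
Proof.
move=> sMN nWN MW; apply: commg_subP => //.
  by apply/subsetP=> _ /imsetP[x Mx ->]; rewrite groupX ?(subsetP sMN).
by move=> _ y /imsetP[x Mx ->]; apply: MW.
Qed.

(** The derived subgroup of [<x, [x, y]>] comes from [[x, y, x]] alone, which lies in [[M, N, N]].
    This gains one step over the bound that follows from [x] being in [M]. *)
Lemma lcs_commg_icomm M N x y n z : M <| N -> x \in M -> y \in N ->
    lcs (gen (fun z => z = x \/ z = [~ x, y])) n.+1 z ->
  z \in icomm M N n.+2.
Proof.
move=> nMN Mx Ny; have [sMN _] := andP nMN; have Nx := subsetP sMN x Mx.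
have Ic : [~ x, y] \in icomm M N 1 by apply: mem_commg.
have sIN k := subsetP (proj1 (andP (icomm_normal k nMN))).
have nIN k := proj2 (andP (icomm_normal k nMN)).
set L := gen _; have LN : forall u, L u -> u \in N.
  apply: gen_min; first exact: subgroup_mem.
  by move=> _ [->|->] //; apply: sIN Ic.
elim: n z => [|n IHn]; apply: gen_min; try exact: subgroup_mem; last first.
  by move=> _ [u [v [/IHn Iu /LN Nv ->]]]; apply: mem_commg.
move=> _ [u [v [Lu Lv ->]]].
have Icx : [~ x, y, x] \in icomm M N 2 by apply: mem_commg.
pose C u := u \in icomm M N 2; suff /(_ u v Lu Lv) : commutes_into L L C by [].
apply: (@commutes_gen _ (fun u => u \in N)); try exact: subgroup_mem.
- by move=> w g Iw Ng; rewrite /C memJ_norm // (subsetP (nIN 2)).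
- by move=> w Lw; apply/LN/Gen.
- by move=> w Lw; apply/LN/Gen.
move=> _ _ [->|->] [->|->]; rewrite /C ?commgg ?group1 //.
by rewrite -groupV commg_inv.
Qed.

(* The groups [[M,_i N]^p,_(r-i) N], with [r = p - 2], are killed modulo [W] by
   descending induction on [i]. *)
Lemma potent_power_odd p M N : prime p -> 2 < p -> p.-group N -> M <| N ->
    icomm M N (p - 2) \subset power_subgroup M p ->
  icomm [group of power_subgroup M p] N (p - 2)
    \subset power_subgroup (power_subgroup M p) p.
Proof.
move=> pr_p p2 pN nMN; set r := (p - 2)%N => sMr.
set P := [group of power_subgroup M p]; set Y := [group of power_subgroup P p].
have nPN : P <| N by apply: power_subgroup_normal.
have nYN : Y <| N by apply: power_subgroup_normal.
have nXN := icomm_normal r nPN; have nIN i := icomm_normal i nMN.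
apply: (sub_frattini_ext pN nXN nYN); set W := frattini_ext _ _ _.
have nWN : W <| N by apply: frattini_ext_normal.
have YW : Y \subset W by rewrite joing_subl.
have RW : icomm P N r.+1 \subset W.
  by rewrite (subset_trans _ (joing_subr _ _)) // joing_subr.
pose A i := [group of power_subgroup (icomm M N i) p].
have nAN i : A i <| N by apply: power_subgroup_normal.
(* In the Hall-Petrescu formula for [x] and [[x, y]], the binomials with [1 < k < p] are divisible
   by [p], and the term [k = p = r + 2] lies in [[M,_(i+p) N] <= [P,_(i+2) N]]. *)
have key i : [~: A i, N] \subset A i.+1 <*> icomm P N i.+2.
  pose Wi := (A i.+1 <*> icomm P N i.+2)%G.
  have nWi : Wi <| N by apply: normalY => //; apply: icomm_normal.
  have AWi x : x \in A i.+1 -> x \in Wi by apply/subsetP/joing_subl.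
  apply: (@commg_power_subgroup_sub _ _ Wi) => [||x y Ix Ny].
  - by case/andP: (nIN i).
  - by case/andP: nWi.
  have Ic : [~ x, y] \in icomm M N i.+1 by apply: mem_commg.
  apply: (commXg_subgroup (subgroup_mem Wi)); last first.
    by apply: AWi; apply: mem_power_subgroup.
  move=> [|[|k]] z /andP[//= _ kp] /(lcs_commg_icomm (nIN i) Ix Ny).
  rewrite icommD => Iz; case: (ltngtP k.+2 p) kp => // [kp _|e _].
    have /dvdnP[m ->] := prime_dvd_bin (k := k.+2) pr_p kp.
    rewrite mulnC expgM groupX // AWi // mem_power_subgroup //.
    by apply: subsetP Iz; apply: icomm_leq => //; lia.
  rewrite e binn expg1; apply: subsetP Iz.
  apply: subset_trans (joing_subr _ _).
  have -> : (i + k.+2 = r + i.+2)%N by rewrite /r; lia.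
  by rewrite -icommD icommS.
suff main d i : (i + d)%N = r -> icomm (A i) N d \subset W by apply: (main r 0).
elim: d i => [|d IHd] i id.
  apply: subset_trans YW; rewrite addn0 in id.
  by rewrite /= id; apply: power_subgroupS.
have -> : icomm (A i) N d.+1 = icomm (icomm (A i) N 1) N d by rewrite icommD.
apply: subset_trans (icommS _ _ (key i)) _.
apply: subset_trans (icommY _ _ _) _ => //; first exact: icomm_normal.
(* The error term becomes [[P,_(r+1) N]], which is contained in [W]. *)
rewrite join_subG IHd ?addSnnS // icommD.
by have -> : (i.+2 + d = r.+1)%N by lia.
Qed.

(** Hall-Petrescu with exponent 4, modulo [W]. The term [k = 2] is a sixth power of an element of
    [[M, N, N] <= [P, N]], killed by the Frattini part; the terms [k = 3, 4] lie in [[P, N, N]]; and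
    [[x, y] ^+ 4] lies in [P^4]. *)
Lemma potent_power_two M N : 2.-group N -> M <| N ->
    [~: M, N] \subset power_subgroup M 4 ->
  [~: power_subgroup M 4, N] \subset power_subgroup (power_subgroup M 4) 4.
Proof.
move=> pN nMN sM; have [sMN _] := andP nMN.
set P := [group of power_subgroup M 4]; set Y := [group of power_subgroup P 4].
have nPN : P <| N by apply: power_subgroup_normal.
have nYN : Y <| N by apply: power_subgroup_normal.
have nXN := icomm_normal 1 nPN; have pX := pgroupS (normal_sub nXN) pN.
apply: (sub_frattini_ext pN nXN nYN); set W := frattini_ext _ _ _.
have nWN : W <| N by apply: frattini_ext_normal.
have YW : Y \subset W by rewrite joing_subl.
have RW : icomm P N 2 \subset W.
  by rewrite (subset_trans _ (joing_subr _ _)) // joing_subr.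
have PW z : z \in icomm P N 1 -> z ^+ 2 \in W.
  move=> Xz; apply: (subsetP (joing_subr _ _)).
  apply: (subsetP (joing_subl _ _)).
  rewrite (Phi_joing pX) (subsetP (joing_subr _ _)) //.
  by apply: (Mho_p_elt 1 Xz); apply: mem_p_elt pX Xz.
apply: commg_power_subgroup_sub => //; first by case/andP: nWN.
move=> x y Mx Ny.
have Pc : [~ x, y] \in P by apply: (subsetP sM); apply: mem_commg.
apply: (commXg_subgroup (subgroup_mem W)); last first.
  by apply: (subsetP YW); apply: mem_power_subgroup.
have sI n : icomm M N n.+1 \subset icomm P N n.
  by rewrite -(icommD M N 1) icommS.
move=> [|[|k]] z /andP[//= _ k4] /(lcs_commg_icomm nMN Mx Ny)/(subsetP (sI _)).
case: k k4 => [_ Xz|k _ Rz].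
  by rewrite (expgM z 2 3) groupX // PW.
apply/groupX/(subsetP RW); apply: subsetP Rz.
exact: (@icomm_leq P N 2).
Qed.

(* The two cases of potency, as [N,_r N] <= N^(p^a). *)
Definition potency_shape (p a r : nat) :=
  [/\ 2 < p, a = 1%N & r = p - 2]%N \/ [/\ p = 2, a = 2 & r = 1]%N.

(** * The chain of iterated power subgroups *)

Section PowerChain.
Variables (p a r : nat) (N : {group gT}).
Hypotheses (pr_p : prime p) (pN : p.-group N).
Hypothesis par : potency_shape p a r.
Hypothesis sNr : icomm N N r \subset power_subgroup N (p ^ a).

Definition pchain j : {group gT} :=
  iter j (fun A : {group gT} => [group of power_subgroup A (p ^ a)]) N.

Lemma pchainS j : pchain j.+1 = [group of power_subgroup (pchain j) (p ^ a)].
Proof. by []. Qed.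

Lemma pchain_char j : pchain j \char N.
Proof.
elim: j => [|j IHj]; first exact: char_refl.
exact: char_trans (power_subgroup_char _ _) IHj.
Qed.

Lemma pchain_normal j : pchain j <| N.
Proof. exact/char_normal/pchain_char. Qed.

Lemma icomm_pchain j : icomm (pchain j) N r \subset pchain j.+1.
Proof.
elim: j => // j IHj; have nM := pchain_normal j.
case: par => [[p2 ea er]|[ep ea er]].
  have := @potent_power_odd p (pchain j) N pr_p p2 pN nM.
  rewrite pchainS in IHj *; rewrite !pchainS !ea !expn1 er in IHj *.
  by apply.
have := @potent_power_two (pchain j) N _ nM; rewrite -{1}ep => /(_ pN).
rewrite !pchainS !ea !ep er in IHj *.
exact.
Qed.

Lemma icomm_pchainM j k : icomm (pchain j) N (k * r) \subset pchain (j + k).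
Proof.
elim: k => [|k IHk]; first by rewrite addn0.
rewrite mulSn addnC -icommD addnS.
exact: subset_trans (icommS _ _ IHk) (icomm_pchain _).
Qed.

Lemma lcs_pchain j k n x : k * r <= n ->
  lcs (fun z => z \in pchain j) n x -> x \in pchain (j + k).
Proof.
move=> kn Lx; apply: (subsetP (icomm_pchainM j k)).
apply: subsetP (icomm_leq (pchain_normal j) kn) _ _.
exact: lcs_icomm (pchain_normal j) _ Lx.
Qed.

Lemma pchain_expg j k x :
  x \in pchain j -> x ^+ ((p ^ a) ^ k) \in pchain (j + k).
Proof.
elim: k => [|k IHk] Nx; first by rewrite addn0 expn0 expg1.
by rewrite expnSr expgM addnS pchainS; apply/mem_power_subgroup/IHk.
Qed.

(** Passing from iterated powers to a single power makes the exponent of [N] control the length of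
    the chain. By induction an element of [pchain j] is a product of [(p ^ a) ^ j]-th powers, and
    [lcs_exponent] puts its [p ^ a]-th power into [W]. *)
Lemma pchain_sub_power j : pchain j \subset power_subgroup N ((p ^ a) ^ j).
Proof.
elim: j => [|j IHj].
  by apply/subsetP=> x Nx; rewrite expn0 -[x]expg1 mem_power_subgroup.
set X := pchain j.+1; set Y := [group of power_subgroup N ((p ^ a) ^ j.+1)].
have nXN : X <| N by apply: pchain_normal.
have nYN : Y <| N by apply/power_subgroup_normal/normal_refl.
have pX := pgroupS (normal_sub nXN) pN.
apply: (sub_frattini_ext pN nXN nYN); set W := frattini_ext _ _ _.
have nWN : W <| N by apply: frattini_ext_normal.
have YW : Y \subset W by rewrite joing_subl.
have RW : icomm X N 1 \subset W.
  by rewrite (subset_trans _ (joing_subr _ _)) // joing_subr.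
have XW z : z \in X -> z ^+ p \in W.
  move=> Xz; apply: (subsetP (joing_subr _ _)).
  apply: (subsetP (joing_subl _ _)).
  rewrite (Phi_joing pX) (subsetP (joing_subr _ _)) //.
  by rewrite -[p in z ^+ p]expn1; apply: (Mho_p_elt 1 Xz (mem_p_elt pX Xz)).
have sNj := normal_sub (pchain_normal j).
rewrite gen_subG; apply/subsetP=> _ /imsetP[z Nz ->].
pose S x := exists2 y, y \in N & x = y ^+ ((p ^ a) ^ j).
pose H x := gen S x.
have Hz : H z.
  elim: (mem_genP (subsetP IHj z Nz)) =>
    {z Nz} [_ /imsetP[y Ny ->]||x y _ Hx _ Hy|x _ Hx].
  - by apply: Gen; exists y.
  - exact: Gen1.
  - exact: GenM.
  - exact: GenV.
have HN x : H x -> x \in pchain j.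
  move: x; apply: gen_min; first exact: subgroup_mem.
  by move=> _ [y Ny ->]; apply: (@pchain_expg 0).
have lX n x : r <= n -> lcs H n x -> x \in X.
  move=> rn Lx; rewrite /X -addn1.
  apply: (lcs_pchain (n := n)); first by rewrite mul1n.
  by apply: lcs_morph Lx => //; apply: subgroup_mem.
have lR n x : r < n -> lcs H n x -> x \in W.
  move=> rn Lx; apply: (subsetP RW).
  apply: (subsetP (icommS _ 1 (icomm_pchain j))).
  rewrite icommD addn1; apply: (subsetP (icomm_leq (pchain_normal j) rn)).
  exact: lcs_icomm (pchain_normal j) HN Lx.
have S1 : subgroup H by apply: subgroup_gen.
apply: (@lcs_exponent _ p (fun x => x \in W) pr_p (subgroup_mem W) a 0 H S
          _ S1 _ _ _ _ _ 0 z _ Hz) => //.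
- move=> x g Wx /HN Ng; rewrite memJ_norm //.
  by rewrite (subsetP (normal_norm nWN)) // (subsetP sNj).
- by move=> x; apply: Gen.
- move=> _ [y Ny ->]; rewrite -expgM -expnSr; apply: (subsetP YW).
  exact: mem_power_subgroup.
move=> i x; rewrite addn0 => ia Lx.
(* For odd [p], [gamma_p(H) <= [X, N]]. For [p = 2], squares of elements of [gamma_2(H) <= X] lie in
   [Phi(X)], and [gamma_4(H) <= [X, N]]. *)
case: par => [[p2 ea er]|[ep ea er]].
  have ei : i = 1%N by lia.
  rewrite ei ea expn1 expg1 in Lx *.
  by apply: lR Lx; lia.
have [ei|ei] : i = 1%N \/ i = 2 by lia.
  rewrite ei ea expn1; apply: XW; apply: lX Lx; rewrite ei ep er //.
by rewrite ei ea expg1; apply: lR Lx; rewrite ei ep er.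
Qed.

Lemma pchain_eq1 m x : (forall y, y \in N -> y ^+ ((p ^ a) ^ m) = 1) ->
  x \in pchain m -> x = 1.
Proof.
move=> N1 /(subsetP (pchain_sub_power m)) Nx; apply/set1P; apply: subsetP x Nx.
by rewrite gen_subG; apply/subsetP=> _ /imsetP[y Ny ->]; rewrite N1 ?inE.
Qed.

End PowerChain.

End FinitePGroups.

(** * The group nu(G) *)

Section WordValues.
Variables (X : choiceType) (T : groupType) (f : X -> T).
Implicit Types u v w : word X.

Definition letter_val (l : X * bool) : T := if l.2 then f l.1 else (f l.1)^-1.

Definition word_val w : T := foldr (fun l x => letter_val l * x) 1 w.

Lemma word_val_cat u v : word_val (u ++ v) = word_val u * word_val v.
Proof. by elim: u => [|l u IHu] /=; rewrite ?mul1g // IHu mulgA. Qed.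

Lemma word_val_inv w : word_val (winv w) = (word_val w)^-1.
Proof.
elim: w => [|[x b] w IHw]; first by rewrite /= invg1.
rewrite /winv map_cons rev_cons -cats1 word_val_cat -/(winv w) IHw /=.
rewrite mulg1 invgM.
by rewrite /letter_val; case: b; rewrite //= invgK.
Qed.

Lemma word_val_conj u v : word_val (wconj u v) = word_val u ^ word_val v.
Proof. by rewrite /wconj !word_val_cat word_val_inv. Qed.

Lemma word_val_comm u v : word_val (wcomm u v) = [~ word_val u, word_val v].
Proof. by rewrite /wcomm !word_val_cat !word_val_inv. Qed.

End WordValues.

(** * Congruence modulo a normal subgroup *)

Section Congruence.
Variables (T : groupType) (K : T -> Prop).
Hypotheses (sK : subgroup K) (nK : normalized K (fun=> True)).

Let KJ g x : K x -> K (x ^ g). Proof. by move=> Kx; apply: nK. Qed.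

Definition cong x y := K (x^-1 * y).

Lemma cong_refl x : cong x x.
Proof. by rewrite /cong mulVg; case: sK. Qed.

Lemma cong_sym x y : cong x y -> cong y x.
Proof. by case: sK => _ _ KV /KV; rewrite invgM invgK. Qed.

Lemma cong_trans y x z : cong x y -> cong y z -> cong x z.
Proof.
by case: sK => _ KM _ Kxy /(KM _ _ Kxy); rewrite /cong mulgA mulgK.
Qed.

Lemma congM x y x' y' : cong x x' -> cong y y' -> cong (x * y) (x' * y').
Proof.
case: sK => _ KM _ /(KJ y) Kx /(KM _ _ Kx).
suff -> : (x^-1 * x') ^ y * (y^-1 * y') = (x * y)^-1 * (x' * y') by [].
by gsimpl.
Qed.

Lemma congV x y : cong x y -> cong x^-1 y^-1.
Proof.
case: sK => _ _ KV /KV/(KJ x^-1).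
suff -> : ((x^-1 * y)^-1) ^ x^-1 = x^-1^-1 * y^-1 by [].
by gsimpl.
Qed.

Lemma congJ x y x' y' : cong x x' -> cong y y' -> cong (x ^ y) (x' ^ y').
Proof.
by move=> cx cy; rewrite !conjgE; do 2?apply: congM => //; apply: congV.
Qed.

Lemma congR x y x' y' : cong x x' -> cong y y' -> cong [~ x, y] [~ x', y'].
Proof.
move=> cx cy; rewrite !commgEl.
by apply: congM; [apply: congV | apply: congJ].
Qed.

Lemma congX n x y : cong x y -> cong (x ^+ n) (y ^+ n).
Proof.
move=> cxy; elim: n => [|n IHn]; first by rewrite !expg0; apply: cong_refl.
by rewrite !expgS; apply: congM.
Qed.

Lemma cong1 x : cong 1 x -> K x.
Proof. by rewrite /cong invg1 mul1g. Qed.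

(** Von Dyck's principle modulo [K]. A trivial [K] yields homomorphisms out of a presented group; a
    normal closure [nker M] yields maps that are homomorphisms up to [K]. *)
Lemma word_val_cong (X : choiceType) (f : X -> T)
    (R : word X -> word X -> Prop) u v :
    (forall u v, R u v -> cong (word_val f u) (word_val f v)) ->
  word_eq R u v -> cong (word_val f u) (word_val f v).
Proof.
move=> RK; elim=> {u v}
  [u v /RK //|x b|u u' v v' _ cu _ cv|u|u v _ cuv|u v w _ cuv _ cvw].
- rewrite /= mulg1 /letter_val /=.
  by case: b => /=; rewrite ?mulgV ?mulVg; apply: cong_refl.
- by rewrite !word_val_cat; apply: congM.
- exact: cong_refl.
- exact: cong_sym.
- exact: cong_trans cvw.
Qed.

End Congruence.

Section PresentedGroups.
Variables (X : choiceType) (R : word X -> word X -> Prop).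

Lemma word_class_mul (u v : word X) :
  word_class R u * word_class R v = word_class R (u ++ v).
Proof. exact: word_class_cat. Qed.

Lemma word_class_inv (u : word X) : (word_class R u)^-1 = word_class R (winv u).
Proof. exact: word_class_winv. Qed.

Lemma word_class_conj (u v : word X) :
  word_class R u ^ word_class R v = word_class R (wconj u v).
Proof. by rewrite conjgE word_class_inv (word_class_mul u) word_class_mul. Qed.

Lemma word_class_comm (u v : word X) :
  [~ word_class R u, word_class R v] = word_class R (wcomm u v).
Proof. by rewrite commgEl word_class_conj word_class_inv word_class_mul. Qed.

Lemma word_class_val (w : word X) :
  word_class R w = word_val (fun x => word_class R [:: (x, true)]) w.
Proof.
elim: w => [|[x b] w IHw] //=; rewrite -IHw /letter_val /=.
by case: b; rewrite ?word_class_inv word_class_mul.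
Qed.

Variables (T : groupType) (f : X -> T).

Definition presented_val (x : presented R) : T := word_val f (repr x).

Hypothesis Rf : forall u v, R u v -> word_val f u = word_val f v.

Lemma presented_val_class w : presented_val (word_class R w) = word_val f w.
Proof.
apply: (mulgI (word_val f (repr (word_class R w)))^-1).
rewrite mulVg; apply/esym.
apply: (word_val_cong (@subgroup1 T) (@normalized1 T _) (R := R)).
  by move=> u v /Rf e; rewrite /cong e mulVg.
exact: word_eq_repr.
Qed.

Lemma presented_valM : {morph presented_val : x y / x * y}.
Proof.
move=> x y; rewrite -[x]word_class_repr -[y]word_class_repr word_class_mul.
by rewrite !presented_val_class word_val_cat.
Qed.

End PresentedGroups.

(** * The maps from nu(G) to G, and the action on and of [[G, G^phi]] *)

Section NuCalculus.
Variable G : groupType.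
Implicit Types (a b c g : G) (t v x : nu G).

Definition nuL g : nu G := word_class (@nu_rel G) (nu_base g).
Definition nuR g : nu G := word_class (@nu_rel G) (nu_copy g).
Definition nu_gen (s : G + G) : nu G :=
  match s with inl g => nuL g | inr g => nuR g end.

Lemma nuLM : {morph nuL : a b / a * b}.
Proof.
move=> a b; rewrite /nuL (word_class_mul _ (nu_base a)).
exact/esym/word_classP/WordRel/NuMulL.
Qed.

Lemma nuRM : {morph nuR : a b / a * b}.
Proof.
move=> a b; rewrite /nuR (word_class_mul _ (nu_copy a)).
exact/esym/word_classP/WordRel/NuMulR.
Qed.

Lemma nu_conjL a b c : [~ nuL a, nuR b] ^ nuL c = [~ nuL (a ^ c), nuR (b ^ c)].
Proof.
rewrite !word_class_comm word_class_conj.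
exact/word_classP/WordRel/NuConjL.
Qed.

Lemma nu_conjR a b c : [~ nuL a, nuR b] ^ nuR c = [~ nuL (a ^ c), nuR (b ^ c)].
Proof.
rewrite !word_class_comm word_class_conj.
exact/word_classP/WordRel/NuConjR.
Qed.

Lemma nu_genE w : word_class (@nu_rel G) w = word_val nu_gen w.
Proof. by rewrite word_class_val; elim: w => //= -[[] g b] w ->. Qed.

(** Inverses of generators are again generators, so right multiplication by generators reaches every
    element. *)
Lemma nu_ind (P : nu G -> Prop) : P 1 ->
  (forall x g, P x -> P (x * nuL g)) -> (forall x g, P x -> P (x * nuR g)) ->
  forall x, P x.
Proof.
move=> P1 PL PR x; rewrite -[x]word_class_repr nu_genE.
elim/last_ind: (repr x) => [|w [s b] Pw] //.
rewrite -cats1 word_val_cat /= mulg1 /letter_val /=.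
case: s b => g [] /=; auto.
- by rewrite -(morph_inv nuLM); apply: PL.
- by rewrite -(morph_inv nuRM); apply: PR.
Qed.

Definition nu_fst : nu G -> G :=
  presented_val (fun s : G + G => if s is inl g then g else 1).

Definition nu_snd : nu G -> G :=
  presented_val (fun s : G + G => if s is inr g then g else 1).

Definition nu_fold : nu G -> G :=
  presented_val (fun s : G + G => match s with inl g | inr g => g end).

Ltac word_val_simpl :=
  rewrite ?(word_val_conj, word_val_comm) /= /letter_val /=
          ?mulg1 ?comm1g ?commg1 ?conj1g ?conjRg.

Let nu_fst_rel (u v : word (G + G)) : nu_rel u v ->
  word_val (fun s : G + G => if s is inl g then g else 1) u =
  word_val (fun s : G + G => if s is inl g then g else 1) v.
Proof. by case=> *; word_val_simpl. Qed.

Let nu_snd_rel (u v : word (G + G)) : nu_rel u v ->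
  word_val (fun s : G + G => if s is inr g then g else 1) u =
  word_val (fun s : G + G => if s is inr g then g else 1) v.
Proof. by case=> *; word_val_simpl. Qed.

Let nu_fold_rel (u v : word (G + G)) : nu_rel u v ->
  word_val (fun s : G + G => match s with inl g | inr g => g end) u =
  word_val (fun s : G + G => match s with inl g | inr g => g end) v.
Proof. by case=> *; word_val_simpl. Qed.

Lemma nu_fstM : {morph nu_fst : x y / x * y}.
Proof. exact: (presented_valM nu_fst_rel). Qed.

Lemma nu_sndM : {morph nu_snd : x y / x * y}.
Proof. exact: (presented_valM nu_snd_rel). Qed.

Lemma nu_foldM : {morph nu_fold : x y / x * y}.
Proof. exact: (presented_valM nu_fold_rel). Qed.

Lemma nu_fstL g : nu_fst (nuL g) = g.
Proof. by rewrite /nu_fst (presented_val_class nu_fst_rel) /= mulg1. Qed.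
Lemma nu_fstR g : nu_fst (nuR g) = 1.
Proof. by rewrite /nu_fst (presented_val_class nu_fst_rel) /= mulg1. Qed.
Lemma nu_sndL g : nu_snd (nuL g) = 1.
Proof. by rewrite /nu_snd (presented_val_class nu_snd_rel) /= mulg1. Qed.
Lemma nu_sndR g : nu_snd (nuR g) = g.
Proof. by rewrite /nu_snd (presented_val_class nu_snd_rel) /= mulg1. Qed.
Lemma nu_foldL g : nu_fold (nuL g) = g.
Proof. by rewrite /nu_fold (presented_val_class nu_fold_rel) /= mulg1. Qed.
Lemma nu_foldR g : nu_fold (nuR g) = g.
Proof. by rewrite /nu_fold (presented_val_class nu_fold_rel) /= mulg1. Qed.

Definition tensor : nu G -> Prop :=
  gen (fun t => exists a b, t = [~ nuL a, nuR b]).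

Lemma tensor_conjLR t g : tensor t -> t ^ nuL g = t ^ nuR g.
Proof.
elim=> {t} [_ [a [b ->]]||x y _ ex _ ey|x _ ex]; rewrite ?conj1g //.
- by rewrite nu_conjL nu_conjR.
- by rewrite !conjMg ex ey.
- by rewrite !conjVg ex.
Qed.

Lemma tensor_conj t v : tensor t -> tensor (t ^ v).
Proof.
have conjL g s : tensor s -> tensor (s ^ nuL g).
  move=> Ts; apply: (@normalized_gen _ _ (eq (nuL g))) => // _ _ [a [b ->]] <-.
  by rewrite nu_conjL; exists (a ^ g), (b ^ g).
move: v t; apply: nu_ind => [t|x g IH t Tt|x g IH t Tt].
  by rewrite conjg1.
  by rewrite conjgM; apply/conjL/IH.
by rewrite conjgM -tensor_conjLR; [apply/conjL/IH | apply: IH].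
Qed.

Lemma tensor_actL t v : tensor t -> t ^ v = t ^ nuL (nu_fold v).
Proof.
move=> Tt; move: v; apply: nu_ind => [|x g IH|x g IH].
- by rewrite (morph_id1 nu_foldM) (morph_id1 nuLM).
- by rewrite nu_foldM nu_foldL nuLM !conjgM IH.
- rewrite nu_foldM nu_foldR nuLM !conjgM -IH tensor_conjLR //.
  exact: tensor_conj.
Qed.

Lemma tensor_actR t v : tensor t -> t ^ v = t ^ nuR (nu_fold v).
Proof. by move=> Tt; rewrite -tensor_conjLR // tensor_actL. Qed.

Lemma tensorLR a b : tensor [~ nuL a, nuR b].
Proof. by apply: Gen; exists a, b. Qed.

Lemma tensorRL a b : tensor [~ nuR a, nuL b].
Proof. by rewrite -commg_inv; apply/GenV/tensorLR. Qed.

(** This is the defining relation for [[x ^ c^-1, b^phi] ^ c], read as a statement on conjugates of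
    [x]. *)
Lemma nuL_conjR (x b c : G) : nuL x ^ (nuR b ^ nuL c) = nuL x ^ nuR (b ^ c).
Proof.
apply: (mulgI (nuL x)^-1); rewrite -!commgEl.
rewrite -{2}[x](conjgKV c) -nu_conjL conjRg -(morph_conj nuLM).
by rewrite conjgKV.
Qed.

Lemma nuR_conjL (x b c : G) : nuR x ^ (nuL b ^ nuR c) = nuR x ^ nuL (b ^ c).
Proof.
apply: (mulgI (nuR x)^-1); rewrite -!commgEl.
rewrite -(commg_inv (nuL b ^ nuR c)) -(commg_inv (nuL (b ^ c))).
congr (_^-1).
rewrite -{2}[x](conjgKV c) -nu_conjR conjRg -(morph_conj nuRM).
by rewrite conjgKV.
Qed.

Section TensorAction.
Variables (u : G -> nu G) (x : nu G).
Hypothesis uM : {morph u : a b / a * b}.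
Hypothesis actu : forall t v, tensor t -> t ^ v = t ^ u (nu_fold v).
Hypothesis xuT : forall g, tensor [~ x, u g].

Let acts t := x ^ t = x ^ u (nu_fold t).

(** Write [x ^ u g = x * [~ x, u g]]: the second factor is in [tensor], where [v] acts as
    [u (nu_fold v)]. This is what allows actions on [x] to be composed. *)
Let conj_acts g v : acts v -> (x ^ u g) ^ v = x ^ u (g * nu_fold v).
Proof.
rewrite /acts uM conjgM => xv.
rewrite -[x ^ u g](mulKVg x) -commgEl (conjMg x) (conjMg x _ (u _)).
by rewrite xv (actu v (xuT g)).
Qed.

Let actsM s t : acts s -> acts t -> acts (s * t).
Proof. by move=> xs xt; rewrite /acts conjgM xs conj_acts // nu_foldM. Qed.

Let actsV t : acts t -> acts t^-1.
Proof.
move=> /(conj_acts (nu_fold t)^-1); rewrite mulVg (morph_id1 uM) conjg1 => e.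
by rewrite /acts -{1}e conjgK (morph_inv nu_foldM).
Qed.

(* [nuR_conjL] only handles commutators written [nuR b, nuL a], hence the
   disjunction. *)
Lemma conj_tensor t :
    (forall a b, acts [~ nuL a, nuR b] \/ acts [~ nuR b, nuL a]) -> tensor t ->
  x ^ t = x ^ u (nu_fold t).
Proof.
move=> actLR; elim=> {t} [_ [a [b ->]]||s t _ xs _ xt|t _ xt].
- by case: (actLR a b) => // /actsV; rewrite commg_inv.
- by rewrite (morph_id1 nu_foldM) (morph_id1 uM).
- exact: actsM.
- exact: actsV.
Qed.

End TensorAction.

Lemma nuL_conj_tensor g t : tensor t -> nuL g ^ t = nuL g ^ nuR (nu_fold t).
Proof.
apply: conj_tensor => [|s v|h|a b];
  [exact: nuRM | exact: tensor_actR | exact: tensorLR | left].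
(* The commutator is a conjugate of [nuR b^-1] by [nuL a], times [nuR b]; [nuL_conjR] carries out
   that conjugation inside [G]. *)
rewrite (morph_comm nu_foldM) nu_foldL nu_foldR !commgEr nuRM -(morph_inv nuRM).
by rewrite (conjgM _ (_ ^ nuL a)) nuL_conjR -conjgM.
Qed.

Lemma nuR_conj_tensor g t : tensor t -> nuR g ^ t = nuR g ^ nuL (nu_fold t).
Proof.
apply: conj_tensor => [|s v|h|a b];
  [exact: nuLM | exact: tensor_actL | exact: tensorRL | right].
rewrite (morph_comm nu_foldM) nu_foldL nu_foldR !commgEr nuLM -(morph_inv nuLM).
by rewrite (conjgM _ (_ ^ nuR b)) nuR_conjL -conjgM.
Qed.

Lemma nu_decomp v :
  exists2 t, tensor t & v = nuL (nu_fst v) * nuR (nu_snd v) * t.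
Proof.
move: v; apply: nu_ind => [|x g [t Tt e]|x g [t Tt e]].
- exists 1; first exact: Gen1.
  rewrite (morph_id1 nu_fstM) (morph_id1 nu_sndM) (morph_id1 nuLM).
  by rewrite (morph_id1 nuRM) !mulg1.
- exists ([~ nuR (nu_snd x), nuL g] * t ^ nuL g).
    by apply: GenM; [apply: tensorRL | apply: tensor_conj].
  rewrite nu_fstM nu_sndM nu_fstL nu_sndL mulg1 nuLM {1}e.
  by gsimpl.
- exists (t ^ nuR g); first exact: tensor_conj.
  rewrite nu_fstM nu_sndM nu_fstR nu_sndR mulg1 nuRM {1}e.
  by gsimpl.
Qed.

(** * Normal closures of a subgroup and its copy *)

Implicit Type M : G -> Prop.

Definition nker M : nu G -> Prop :=
  gen (fun x => exists m v, M m /\ (x = nuL m ^ v \/ x = nuR m ^ v)).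

Lemma subgroup_nker M : subgroup (nker M).
Proof. exact: subgroup_gen. Qed.

Lemma nker_normalized M : normalized (nker M) (fun=> True).
Proof.
apply: normalized_gen => x g [m [v [Mm e]]] _; exists m, (v * g); split=> //.
by case: e => ->; rewrite -conjgM; [left | right].
Qed.

Lemma nkerJ M x v : nker M x -> nker M (x ^ v).
Proof. by move=> Kx; apply: nker_normalized. Qed.

Lemma nkerL M m : M m -> nker M (nuL m).
Proof. by move=> Mm; apply: Gen; exists m, 1; rewrite !conjg1; auto. Qed.

Lemma nkerR M m : M m -> nker M (nuR m).
Proof. by move=> Mm; apply: Gen; exists m, 1; rewrite !conjg1; auto. Qed.

(* Write k = a b^phi t with t in the tensor part. Then t acts on g and g^phi as
   its image in G does on the other side, so [k, v] depends only on the images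
   of k. *)
Lemma nker_comm M k v : subgroup M ->
  M (nu_fst k) -> M (nu_snd k) -> M (nu_fold k) -> nker M [~ k, v].
Proof.
move=> [_ MM MV] M1 M2 M3; have [K1 KM KV] := subgroup_nker M.
have KR x y : nker M x -> nker M [~ x, y].
  by move=> Kx; rewrite commgEl; apply: KM; [apply: KV | apply: nkerJ].
have [t Tt e] := nu_decomp k.
have Mt : M (nu_fold t).
  have -> : nu_fold t = (nu_fst k * nu_snd k)^-1 * nu_fold k.
    by rewrite {3}e !nu_foldM nu_foldL nu_foldR mulKg.
  by apply: (MM) => //; apply/MV/MM.
have Kt g : nker M [~ t, nuL g] /\ nker M [~ t, nuR g].
  rewrite -!(commg_inv _ t) !(commgEl _ t).
  rewrite nuL_conj_tensor // nuR_conj_tensor //.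
  rewrite -!commgEl !commg_inv.
  by split; apply: KR; [apply: nkerR | apply: nkerL].
have Kk y : nker M [~ t, y] -> nker M [~ k, y].
  move=> Kty; rewrite e commgM_l; apply: (KM) => //; apply/nkerJ/KR.
  by apply: KM; [apply: nkerL | apply: nkerR].
move: v; apply: nu_ind => [|v g Kv|v g Kv]; first by rewrite commg1.
- by rewrite commgM_r; apply: KM; [apply/Kk; case: (Kt g) | apply: nkerJ].
- by rewrite commgM_r; apply: KM; [apply/Kk; case: (Kt g) | apply: nkerJ].
Qed.

Lemma nker_morph M (f : nu G -> G) : {morph f : x y / x * y} -> subgroup M ->
    normalized M (fun=> True) ->
    (forall g, M g -> M (f (nuL g)) /\ M (f (nuR g))) ->
  forall x, nker M x -> M (f x).
Proof.
move=> fM sM nM Mf; apply: gen_morph => // _ [m [v [/Mf[mL mR] [->|->]]]];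
by rewrite (morph_conj fM); apply: nM.
Qed.

(** The three images of [lcs (nker M) n] lie in [lcs M n], hence in [M']. One further commutator is
    spent on [nker_comm], whence the shift to [n.+1]. *)
Lemma lcs_nker M M' n x :
    subgroup M -> normalized M (fun=> True) -> subgroup M' ->
  (forall g, lcs M n g -> M' g) -> lcs (nker M) n.+1 x -> nker M' x.
Proof.
move=> sM nM sM' MM'; have [M1 _ _] := sM.
have lM (f : nu G -> G) : {morph f : y z / y * z} ->
    (forall g, M g -> M (f (nuL g)) /\ M (f (nuR g))) ->
    forall k, lcs (nker M) n k -> M' (f k).
  move=> fM Mf k Lk; apply: MM'.
  by apply: lcs_morph Lk => //; apply: nker_morph.
move: x; apply: gen_min; first exact: subgroup_nker.
move=> _ [k [v [Lk _ ->]]]; apply: nker_comm => //.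
- by apply: lM Lk; [exact: nu_fstM | move=> g; rewrite nu_fstL nu_fstR].
- by apply: lM Lk; [exact: nu_sndM | move=> g; rewrite nu_sndL nu_sndR].
- by apply: lM Lk; [exact: nu_foldM | move=> g; rewrite nu_foldL nu_foldR].
Qed.

End NuCalculus.

(** * The kernel of nu(A) -> nu(B) for a surjection A -> B *)

Section NuKernel.
Variables (A B : groupType) (f : A -> B).
Hypotheses (fM : {morph f : x y / x * y})
           (f_surj : forall b, exists a, f a = b).

Let M a := f a = 1.
Let K := nker M.
Let sK : subgroup K. Proof. exact: subgroup_nker. Qed.
Let nK : normalized K (fun=> True). Proof. exact: nker_normalized. Qed.

Let cong_nuL a b : f a = f b -> cong K (nuL a) (nuL b).
Proof.
move=> e; rewrite /cong -(morph_inv (@nuLM A)) -nuLM; apply: nkerL.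
by rewrite /M fM (morph_inv fM) e mulVg.
Qed.

Let cong_nuR a b : f a = f b -> cong K (nuR a) (nuR b).
Proof.
move=> e; rewrite /cong -(morph_inv (@nuRM A)) -nuRM; apply: nkerR.
by rewrite /M fM (morph_inv fM) e mulVg.
Qed.

(** A set-theoretic section of [f] evaluates words over [B] in [nu A]. The relations of [nu B] hold
    modulo [K], so the resulting [F] is multiplicative modulo [K]; and [x] is congruent to [F y] for
    the image [y] of [x], so that [x ^+ n] is congruent to [F 1]. *)
Lemma nker_expg n (x : nu A) :
  (forall y : nu B, y ^+ n = 1) -> nker (fun a => f a = 1) (x ^+ n).
Proof.
have [s fs] := choice f_surj; pose h (l : B + B) : nu A :=
  match l with inl b => nuL (s b) | inr b => nuR (s b) end.
pose c := cong K.
have hR u v : nu_rel u v -> c (word_val h u) (word_val h v).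
  case=> [a b|a b|a b d|a b d]; rewrite ?(word_val_conj, word_val_comm) /=
    /letter_val /= ?mulg1.
  - by rewrite -nuLM; apply: cong_nuL; rewrite fM !fs.
  - by rewrite -nuRM; apply: cong_nuR; rewrite fM !fs.
  - rewrite nu_conjL; apply: congR => //; [apply: cong_nuL | apply: cong_nuR];
    by rewrite (morph_conj fM) !fs.
  - rewrite nu_conjR; apply: congR => //; [apply: cong_nuL | apply: cong_nuR];
    by rewrite (morph_conj fM) !fs.
pose F (y : nu B) := word_val h (repr y).
have Fclass w : c (F (word_class _ w)) (word_val h w).
  by apply: (word_val_cong sK nK hR); apply: word_eq_repr.
have F1 : c (F 1) 1 by apply: Fclass [::].
have FM y z : c (F (y * z)) (F y * F z).
  rewrite -[y]word_class_repr -[z]word_class_repr word_class_mul.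
  apply: (cong_trans sK (Fclass _)); rewrite word_val_cat.
  by apply: congM => //; apply: cong_sym => //; apply: Fclass.
have FX y m : c (F (y ^+ m)) (F y ^+ m).
  elim: m => [|m IHm]; first exact: F1.
  rewrite !expgS; apply: (cong_trans sK (FM _ _)).
  by apply: congM => //; apply: cong_refl.
pose fw (w : word (A + A)) : word (B + B) :=
  [seq (match l.1 with inl a => inl (f a) | inr a => inr (f a) end, l.2)
  | l <- w].
have Ffw w : c (word_class _ w) (word_val h (fw w)).
  rewrite nu_genE; elim: w => [|[l b] w IHw] /=; first exact: cong_refl.
  apply: congM => //; rewrite /letter_val.
  by case: l b => a [] /=; try (apply: congV => //);
    [apply: cong_nuL | apply: cong_nuL | apply: cong_nuR | apply: cong_nuR];
    rewrite fs.
move=> Bn; apply: (cong1 (K := K)).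
pose y := word_class (@nu_rel B) (fw (repr x)).
have cxy : c x (F y).
  rewrite -{1}[x]word_class_repr; apply: (cong_trans sK (Ffw _)).
  by apply: cong_sym => //; apply: Fclass.
apply: cong_sym => //; apply: (cong_trans sK (congX sK nK n cxy)).
apply: (cong_trans sK (cong_sym sK (FX _ _))).
by rewrite Bn; apply: F1.
Qed.

End NuKernel.

Lemma nker_sub (G : groupType) (M M' : G -> Prop) x :
  (forall g, M g -> M' g) -> nker M x -> nker M' x.
Proof.
move=> MM'; move: x; apply: gen_min; first exact: subgroup_nker.
by move=> x [m [v [Mm e]]]; apply: Gen; exists m, v; split=> //; apply: MM'.
Qed.

Lemma nker_gen_expg (G : groupType) (M : G -> Prop) n :
    (forall g, M g -> g ^+ n = 1) ->
  forall x, (exists m v, M m /\ (x = nuL m ^ v \/ x = nuR m ^ v)) -> x ^+ n = 1.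
Proof.
have mX (f : G -> nu G) (fM : {morph f : x y / x * y}) m k :
    f m ^+ k = f (m ^+ k).
  elim: k => [|k IHk]; first by rewrite !expg0 (morph_id1 fM).
  by rewrite !expgS fM IHk.
move=> Mn _ [m [v [/Mn m1 [->|->]]]]; rewrite -conjXg mX ?m1.
- by rewrite (morph_id1 (@nuLM G)) conj1g.
- exact: nuLM.
- by rewrite (morph_id1 (@nuRM G)) conj1g.
- exact: nuRM.
Qed.

Lemma nker1 (G : groupType) x : nker (eq^~ (1 : G)) x -> x = 1.
Proof.
move: x; apply: gen_min; first exact: subgroup1.
move=> _ [m [v [-> [->|->]]]].
- by rewrite (morph_id1 (@nuLM G)) conj1g.
- by rewrite (morph_id1 (@nuRM G)) conj1g.
Qed.

(** * Exponent of the normal closure of N and its copy *)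

Section NuExponent.
Variables (p e : nat) (gT : finGroupType) (G N : {group gT}).
Hypotheses (pr_p : prime p) (pN : p.-group N) (nNG : N <| G).
Hypothesis expN : forall x, x \in N -> x ^+ (p ^ e) = 1.

Definition in_subg (A : {set gT}) (g : subg_of G) : Prop := sgval g \in A.

Lemma morph_sgval : {morph (@sgval gT G) : x y / x * y}.
Proof. by move=> x y; apply: sgvalM; rewrite inE. Qed.

Lemma subgroup_in_subg (A : {group gT}) : subgroup (in_subg A).
Proof.
by split=> [|x y|x]; rewrite /in_subg /= ?groupV;
  [exact: group1 | exact: groupM |].
Qed.

Lemma in_subg_normalized (A : {group gT}) :
  A <| G -> normalized (in_subg A) (fun=> True).
Proof.
move=> /andP[_ nAG] x g Ax _.
rewrite /in_subg (morph_conj morph_sgval) memJ_norm //.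
by apply: (subsetP nAG); apply: subgP.
Qed.

Lemma in_subg_expg (A : {set gT}) n : (forall x, x \in A -> x ^+ n = 1) ->
  forall g, in_subg A g -> g ^+ n = 1.
Proof.
move=> An g /An g1; apply: val_inj; rewrite /= -{}g1.
by elim: n {An} => [|n IHn] //; rewrite !expgS /= IHn.
Qed.

Lemma lcs_in_subg (A : {group gT}) n g :
  lcs (in_subg A) n g -> lcs (fun x => x \in A) n (sgval g).
Proof. by apply: lcs_morph => //; apply: subgroup_mem. Qed.

Lemma icomm_lcn n : icomm N N n = 'L_n.+1(N) :> {set gT}.
Proof. by elim: n => //= n ->. Qed.

Lemma nker_exponent_nil : 'L_p(N) = 1 ->
  forall x, nker (in_subg N) x -> x ^+ (p ^ e.+1) = 1.
Proof.
move=> Lp; have p1 := prime_gt1 pr_p.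
apply: (gen_exponentS pr_p (@subgroup_nker _ _) (@Gen _ _) (fun _ => id)).
  exact/nker_gen_expg/in_subg_expg.
move=> j z /andP[j0 _]; have -> : (p ^ j = (p ^ j - 1).+1)%N.
  by rewrite subn1 prednK // expn_gt0 prime_gt0.
move=> Lz; suff -> : z = 1 by rewrite expg1n.
have n1 : nker (eq^~ (1 : subg_of G)) z.
  apply: lcs_nker Lz => [||| g Lg]; first exact: subgroup_in_subg.
  - exact: in_subg_normalized.
  - exact: subgroup1.
  apply: val_inj => /=.
  have le_p : p.-1 <= p ^ j - 1.
    case: j j0 {Lg} => // j _; rewrite expnS.
    have : 0 < p ^ j by rewrite expn_gt0 prime_gt0.
    nia.
  have := lcs_icomm (normal_refl N) (fun _ => id) (lcs_in_subg Lg).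
  move/(subsetP (icomm_leq (normal_refl N) le_p)).
  by rewrite icomm_lcn prednK ?prime_gt0 // Lp => /set1P.
exact: nker1.
Qed.

Lemma lcs_nker_pchain a r j k n z :
    potency_shape p a r ->
    icomm N N r \subset power_subgroup N (p ^ a) -> k * r <= n ->
  lcs (nker (in_subg (pchain p a N j))) n.+1 z ->
  nker (in_subg (pchain p a N (j + k))) z.
Proof.
move=> par sNr kn; have nG i : pchain p a N i <| G.
  exact: char_normal_trans (pchain_char p a N i) nNG.
apply: lcs_nker => [|||g /lcs_in_subg Lg]; try exact: subgroup_in_subg.
  exact: in_subg_normalized.
exact: lcs_pchain pr_p pN par sNr _ _ _ _ kn Lg.
Qed.

(** The power lies in [pchain (j + d)], which is trivial because the exponent of [N] divides
    [p ^ (a * (j + d))]. *)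
Lemma pchain_exponent a r d j x :
    potency_shape p a r ->
    icomm N N r \subset power_subgroup N (p ^ a) -> e <= a * (j + d) ->
  x \in pchain p a N j -> x ^+ (p ^ (a * d)) = 1.
Proof.
move=> par sNr ejd /(pchain_expg d); rewrite -expnM.
apply: (pchain_eq1 pr_p pN par sNr) => y Ny; rewrite -expnM.
by rewrite -(subnKC ejd) expnD expgM expN // expg1n.
Qed.

Lemma nker_exponent_odd : 2 < p ->
    icomm N N (p - 2) \subset power_subgroup N p ->
  forall x, nker (in_subg N) x -> x ^+ (p ^ e) = 1.
Proof.
move=> p2 sN.
have par : potency_shape p 1 (p - 2) by left.
have sN1 : icomm N N (p - 2) \subset power_subgroup N (p ^ 1) by rewrite expn1.
suff main d j x : (j + d = e)%N -> nker (in_subg (pchain p 1 N j)) x ->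
    x ^+ (p ^ d) = 1 by move=> x; apply: (main e 0).
elim/ltn_ind: d j x => d IHd j x jd.
move: x.
apply: (gen_exponent pr_p (@subgroup_nker _ _) (@Gen _ _) (fun _ => id)).
  apply/nker_gen_expg/in_subg_expg => x.
  by have := @pchain_exponent 1 (p - 2) d j x par sN1; rewrite !mul1n jd; apply.
move=> i z /andP[i0 id] Lz.
(* Of the [p ^ i - 1] commutations in [gamma_(p^i)], one is spent on [lcs_nker]; the other
   [p ^ i - 2] suffice for [i] steps of the chain at [p - 2] each. *)
have pi : i * (p - 2) + 2 <= p ^ i.
  case: i i0 {id Lz} => // i _; elim: i => [|i IHi].
    by rewrite mul1n expn1; lia.
  by rewrite expnS; nia.
have {}Lz : nker (in_subg (pchain p 1 N (j + i))) z.
  apply: (@lcs_nker_pchain 1 (p - 2) j i (p ^ i - 2) z par sN1).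
    by rewrite leq_subRL ?(leq_trans (leq_addl _ _) pi) // addnC.
  rewrite (_ : (p ^ i - 2).+1 = p ^ i - 1)%N //.
  by have := leq_trans (leq_addl _ 2) pi; lia.
by apply: (IHd _ _ (j + i)%N) => //; lia.
Qed.

Lemma nker_exponent_two : p = 2 ->
    [~: N, N] \subset power_subgroup N 4 ->
  forall x, nker (in_subg N) x -> x ^+ (2 ^ e.+2) = 1.
Proof.
move=> ep sN.
have par : potency_shape p 2 1 by right.
have sN1 : icomm N N 1 \subset power_subgroup N (p ^ 2) by rewrite ep.
(* Each step of the chain takes fourth powers, so it is trivial after half of [e] steps, rounded
   up. *)
pose m := uphalf e; have em : e <= 2 * m <= e.+1 by rewrite /m; lia.
(* The boolean counts the one factor 2 lost in [gen_exponentS]; nothing is lost at [d = 0], where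
   the group is trivial. *)
suff main d j x : (j + d = m)%N -> nker (in_subg (pchain p 2 N j)) x ->
    x ^+ (2 ^ (2 * d + (0 < d))) = 1.
  move=> x /(main m 0 x (add0n m)).
  have le : 2 * m + (0 < m) <= e.+2 by case: (m) em => [|k] /=; lia.
  move: (2 * m + _)%N le => k /subnKC<-.
  by rewrite expnD expgnA => ->; rewrite expg1n.
elim/ltn_ind: d j x => d IHd j x jd.
have ch1 z : nker (in_subg (pchain p 2 N m)) z -> z = 1.
  move=> Kz; apply/nker1/(nker_sub _ Kz); apply: (@in_subg_expg _ 1) => y Ny.
  apply: (@pchain_exponent 2 1 0 m) Ny => //; rewrite addn0; lia.
case: d jd IHd => [jm _|d jd IHd]; first by rewrite -jm addn0 in ch1 => /ch1->.
suff K x' : nker (in_subg (pchain p 2 N j)) x' -> x' ^+ (p ^ (2 * d.+1).+1) = 1.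
  by move=> /K; rewrite addn1 -ep.
move: x' {x}.
apply: (gen_exponentS pr_p (@subgroup_nker _ _) (@Gen _ _) (fun _ => id)).
  apply/nker_gen_expg/in_subg_expg => x.
  by apply: pchain_exponent par sN1 _; rewrite jd; lia.
move=> i z /andP[i0 id] Lz; have i2 : i < 2 ^ i by apply: ltn_expl.
have {}Lz k : k <= i -> nker (in_subg (pchain p 2 N (j + k))) z.
  move=> ki; apply: (@lcs_nker_pchain 2 1 j k (2 ^ i).-1 z par sN1).
    by rewrite muln1 -ltnS prednK ?expn_gt0 // (leq_ltn_trans ki).
  by rewrite (_ : (2 ^ i).-1.+1 = p ^ i)%N // ep prednK // expn_gt0.
(* Since [i] ranges up to [2 * d.+1], it may reach or pass the end of the chain, and then
   [z = 1]. *)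
have [di|di] := leqP d.+1 i.
  by rewrite (ch1 z) ?expg1n // -jd; apply: Lz.
have := IHd (d.+1 - i)%N _ (j + i)%N z _ (Lz i (leqnn i)).
(* The extra factor 2 of the induction hypothesis is absorbed because [i >= 1]. *)
rewrite ep; have le : 2 * (d.+1 - i) + (0 < d.+1 - i) <= 2 * d.+1 - i by lia.
move: (2 * _ + _)%N le => k /subnKC<-.
by rewrite expnD expgnA => ->; rewrite ?expg1n //; lia.
Qed.

End NuExponent.

Lemma nu_expg_quotient (gT : finGroupType) (G N : {group gT}) n
    (x : nu (subg_of G)) :
    N <| G -> (forall y : nu (subg_of (G / N)%G), y ^+ n = 1) ->
  nker (in_subg N) (x ^+ n).
Proof.
move=> /andP[_ nNG] n1.
pose f (g : subg_of G) : subg_of (G / N)%G :=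
  subg (G / N)%G (coset N (sgval g)).
have nN (g : subg_of G) : sgval g \in 'N(N).
  by apply: (subsetP nNG); apply: subgP.
have fE g : sgval (f g) = coset N (sgval g).
  by rewrite /f subgK //; apply: mem_quotient; apply: subgP.
have fM : {morph f : g h / g * h}.
  by move=> g h; apply: val_inj; rewrite /= !fE /= morphM.
apply: (@nker_sub _ (fun a => f a = 1)); last first.
  apply: (nker_expg fM) n1 => b.
  have /morphimP[a Na Ga ab] := subgP b.
  by exists (subg G a); apply: val_inj; rewrite /= fE subgK.
move=> g /(congr1 (@sgval _ _)); rewrite fE => /=; exact: coset_idr.
Qed.

Theorem theorem1p2 (p : nat) (gT : finGroupType) (G N : {group gT}) :
  prime p -> (p.-group G)%g -> (N <| G)%g ->
  (potent p N \/ ('L_p(N) = 1)%g ->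
   group_exponent (nu (subg_of G)) %|
     bold_prime p * group_exponent (nu (subg_of (G / N)%G)) * exponent N)
  /\
  (3 <= p -> ('L_(p - 2)(N) \subset power_subgroup N p)%g ->
   group_exponent (nu (subg_of G)) %|
     group_exponent (nu (subg_of (G / N)%G)) * exponent N).
Proof.
move=> pr_p pG nNG; have pN := pgroupS (normal_sub nNG) pG.
have /p_natP[e eN] : p.-nat (exponent N) by rewrite pnat_exponent.
have expN x : x \in N -> x ^+ (p ^ e) = 1 by rewrite -eN; apply: expg_exponent.
set m := group_exponent (nu (subg_of (G / N)%G)).
(* This includes the default value [m = 0], for which it reads [x ^+ 0 = 1]. *)
have m1 := (dvdn_group_exponent _ m).1 (dvdnn m).
have main d : (forall x, nker (@in_subg gT G N) x -> x ^+ d = 1) ->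
    group_exponent (nu (subg_of G)) %| m * d.
  move=> Kd; apply/dvdn_group_exponent=> x.
  by rewrite expgnA; apply/Kd/nu_expg_quotient.
(* For odd [p] no factor [p] is lost. This serves both (b), as [gamma_(p-1)(N) <= gamma_(p-2)(N)],
   and the potent case of (a). *)
have odd_case : 2 < p -> 'L_(p - 1)(N) \subset power_subgroup N p ->
    group_exponent (nu (subg_of G)) %| m * exponent N.
  move=> p2 sN; apply: main; rewrite eN.
  apply: (nker_exponent_odd pr_p pN nNG expN p2).
  by rewrite icomm_lcn (_ : (p - 2).+1 = p - 1)%N //; lia.
split=> [|p2 sN]; last first.
  apply: odd_case => //; apply: subset_trans sN; apply: lcn_sub_leq; lia.
rewrite -mulnA mulnCA => -[/andP[_]|Lp].
  case: eqP => [ep sN|np sN].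
    rewrite /bold_prime ep /=; apply: main; rewrite eN ep -(expnD 2 2 e) add2n.
    exact: (nker_exponent_two pr_p pN nNG expN ep).
  rewrite mulnCA; apply/dvdn_mull/odd_case => //.
  by have := prime_gt1 pr_p; lia.
apply: dvdn_trans (main _ (nker_exponent_nil pr_p pN nNG expN Lp)) _.
rewrite eN expnS dvdn_mul // dvdn_mul // /bold_prime.
by case: eqP => [->|].
Qed.
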